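(* Let $R$ be a commutative Noetherian ring with non-zero identity, $\mathfrak a$ an ideal of $R$, $M$ a finitely generated $R$-module, $X$ an arbitrary $R$-module, and $n$ a non-negative integer such that $\operatorname{Ext}^n_R(M/\mathfrak aM,X)$ and $H^i_{\mathfrak a}(X)$, for all $i<n$, are weakly Laskerian. Then: (a) $\operatorname{Hom}_R(R/\mathfrak a,H^n_{\mathfrak a}(M,X))$ is weakly Laskerian. (b) $\operatorname{Ass}_R(H^n_{\mathfrak a}(M,X))$ is finite.
   Context: $H^i_{\mathfrak a}(M,X)=\varinjlim_{k}\operatorname{Ext}^i_R(M/\mathfrak a^kM,X)$ is the $i$-th generalized local cohomology module, and $H^i_{\mathfrak a}(X)=H^i_{\mathfrak a}(R,X)$ is ordinary local cohomology. An $R$-module $Y$ is weakly Laskerian if every quotient module of $Y$ has only finitely many associated primes. *)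

(* Defs.v *)
From HB Require Import structures.
From mathcomp Require Import all_boot all_order all_algebra.
From mathcomp Require Import mathcomp_extra boolp classical_sets functions.
From mathcomp Require Import cardinality.
From mathcomp Require Import freeg.

Set Implicit Arguments.
Unset Strict Implicit.
Unset Printing Implicit Defensive.

Import GRing.Theory.
Local Open Scope ring_scope.
Local Open Scope classical_set_scope.
Local Open Scope quotient_scope.

(* Submodules of V are the library's [submodClosed V], i.e. boolean predicates;
   classically, every set closed under the module operations yields one. *)
Definition is_submod (R : pzRingType) (V : lmodType R) (P : set V) : Prop :=
  P 0 /\ forall c u v, P u -> P v -> P (c *: u + v).

Definition pred_of_set (T : Type) (P : set T) : pred T := fun x => `[< P x >].

Section MkSubmod.
Variables (R : pzRingType) (V : lmodType R) (P : set V) (HP : is_submod P).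

Lemma pred_of_set_submod_closed : subsemimod_closed (pred_of_set P).
Proof.
apply: GRing.submod_closed_semi; case: HP => P0 Plin.
split; first exact/asboolP.
by move=> c u v /asboolP Pu /asboolP Pv; apply/asboolP/Plin.
Qed.

Definition mk_submod : submodClosed V :=
  HB.pack (pred_of_set P)
    (GRing.isSubmodClosed.Build R V (pred_of_set P) pred_of_set_submod_closed).

Lemma mk_submodP x : reflect (P x) (x \in mk_submod).
Proof. exact: asboolP. Qed.

End MkSubmod.

Section Submodules.
Variables (R : pzRingType) (V : lmodType R).

Fact full_submod_subproof : is_submod [set: V].
Proof. by []. Qed.
Definition full_submod : submodClosed V := mk_submod full_submod_subproof.

Fact gen_submod_subproof (G : set V) :
  is_submod [set x | forall S : submodClosed V,
                       (forall g, G g -> g \in S) -> x \in S].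
Proof.
split=> [S _|c u v Gu Gv S GS]; first exact: rpred0.
by apply: rpredD; [apply/rpredZ/Gu | apply: Gv].
Qed.
Definition gen_submod (G : set V) : submodClosed V :=
  mk_submod (gen_submod_subproof G).

Definition fg_submod (S : submodClosed V) : Prop :=
  exists s : seq V, S =i gen_submod [set` s].

End Submodules.

Definition fg_module (R : pzRingType) (M : lmodType R) : Prop :=
  fg_submod (full_submod M).

(* Ideals of R are the submodules of the regular module R^o; the library's
   [idealr] structure only covers proper ideals. *)
Definition noetherian_ring (R : nzRingType) : Prop :=
  forall I : submodClosed R^o, fg_submod I.

Section SubmoduleType.
Variables (R : pzRingType) (V : lmodType R) (S : submodClosed V).

Definition submod_of : Type := {x : V | x \in S}.
HB.instance Definition _ := SubChoice.on submod_of.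
HB.instance Definition _ := [SubChoice_isSubLmodule of submod_of by <:].

End SubmoduleType.

Section QuotientModule.
Variables (R : pzRingType) (V : lmodType R) (S : submodClosed V).

Let Spred : pred V := fun x => x \in S.

Fact submod_zmod_closed : zmod_closed Spred.
Proof. exact/GRing.submod_closedB/submodClosedP. Qed.

Definition submod_zmodClosed : zmodClosed V :=
  HB.pack Spred (GRing.isZmodClosed.Build V Spred submod_zmod_closed).

Definition quot_mod : Type := Quotient.quot submod_zmodClosed.
HB.instance Definition _ := GRing.Zmodule.on quot_mod.
HB.instance Definition _ := EqQuotient.on quot_mod.

Definition quot_proj (x : V) : quot_mod :=
  \pi_(Quotient.quot submod_zmodClosed) x.

Lemma quot_projK (q : quot_mod) : quot_proj (repr q) = q.
Proof. exact: reprK. Qed.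

Lemma quot_projP x y : (quot_proj x == quot_proj y) = (x - y \in S).
Proof. by rewrite -(Quotient.idealrBE submod_zmodClosed). Qed.

Lemma quot_projD x y : quot_proj (x + y) = quot_proj x + quot_proj y.
Proof. by rewrite /quot_proj raddfD. Qed.

Definition quot_scale (c : R) (q : quot_mod) : quot_mod :=
  quot_proj (c *: repr q).

Lemma quot_projZ c x : quot_proj (c *: x) = quot_scale c (quot_proj x).
Proof.
apply/eqP; rewrite quot_projP -scalerBr rpredZ//.
by rewrite -quot_projP quot_projK.
Qed.

Fact quot_scaleA a b q : quot_scale a (quot_scale b q) = quot_scale (a * b) q.
Proof. by rewrite -[q]quot_projK -!quot_projZ scalerA. Qed.
Fact quot_scale1 : left_id 1 quot_scale.
Proof. by move=> q; rewrite -[q]quot_projK -!quot_projZ scale1r. Qed.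
Fact quot_scaleDr : right_distributive quot_scale +%R.
Proof.
move=> c p q; rewrite -[p]quot_projK -[q]quot_projK.
by rewrite -quot_projD -!quot_projZ scalerDr quot_projD.
Qed.
Fact quot_scaleDl q : {morph quot_scale^~ q : a b / a + b}.
Proof.
by move=> a b; rewrite -[q]quot_projK -!quot_projZ scalerDl quot_projD.
Qed.

HB.instance Definition _ := GRing.Zmodule_isLmodule.Build R quot_mod
  quot_scaleA quot_scale1 quot_scaleDr quot_scaleDl.

Fact quot_proj_linear : linear quot_proj.
Proof. by move=> c x y; rewrite quot_projD quot_projZ. Qed.
HB.instance Definition _ :=
  GRing.isLinear.Build R V quot_mod *:%R quot_proj quot_proj_linear.

End QuotientModule.

(* The map V/S -> V'/S' induced by a linear f with f(S) contained in S'. *)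
Section QuotientMap.
Variables (R : pzRingType) (V V' : lmodType R).
Variables (S : submodClosed V) (S' : submodClosed V').
Variables (f : {linear V -> V'}) (fS : forall x, x \in S -> f x \in S').

Definition quot_map_fun (q : quot_mod S) : quot_mod S' :=
  quot_proj S' (f (repr q)).

Fact quot_map_funE x : quot_map_fun (quot_proj S x) = quot_proj S' (f x).
Proof.
apply/eqP; rewrite quot_projP -raddfB; apply: fS.
by rewrite -quot_projP quot_projK.
Qed.

Fact quot_map_linear : linear quot_map_fun.
Proof.
move=> c p q; rewrite -[p]quot_projK -[q]quot_projK.
by rewrite -linearP !quot_map_funE !linearP.
Qed.

Definition quot_map : {linear quot_mod S -> quot_mod S'} :=
  HB.pack quot_map_fun
    (GRing.isLinear.Build R (quot_mod S) (quot_mod S') *:%R quot_map_fun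
       quot_map_linear).

Lemma quot_mapE x : quot_map (quot_proj S x) = quot_proj S' (f x).
Proof. exact: quot_map_funE. Qed.

End QuotientMap.

Section SubmoduleMap.
Variables (R : pzRingType) (V V' : lmodType R).
Variables (S : submodClosed V) (S' : submodClosed V').
Variables (f : {linear V -> V'}) (fS : forall x, x \in S -> f x \in S').

Definition submod_map (x : submod_of S) : submod_of S' :=
  Sub (f (val x)) (fS (valP x)).

Fact submod_map_linear : linear submod_map.
Proof. by move=> c x y; apply: val_inj; rewrite /= !linearP. Qed.
HB.instance Definition _ :=
  GRing.isLinear.Build R (submod_of S) (submod_of S') *:%R submod_map
    submod_map_linear.

End SubmoduleMap.

(* The subquotient Z/(Z ∩ B), which is the usual Z/B when B is contained
   in Z. *)
Section Subquotient.
Variables (R : pzRingType) (V : lmodType R) (Z B : submodClosed V).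

Fact subquot_submod_subproof :
  is_submod [set x : submod_of Z | val x \in B].
Proof.
split=> [|c u v uB vB]; rewrite /mkset; first by rewrite raddf0 rpred0.
by rewrite linearP rpredD ?rpredZ.
Qed.

Definition subquot_submod : submodClosed (submod_of Z) :=
  mk_submod subquot_submod_subproof.

Definition subquot : lmodType R := quot_mod subquot_submod.

End Subquotient.

Section SubquotientMap.
Variables (R : pzRingType) (V V' : lmodType R).
Variables (Z B : submodClosed V) (Z' B' : submodClosed V').
Variables (f : {linear V -> V'}).
Variables (fZ : forall x, x \in Z -> f x \in Z').
Variables (fB : forall x, x \in B -> f x \in B').

Fact subquot_map_subproof (x : submod_of Z) :
  x \in subquot_submod Z B -> submod_map fZ x \in subquot_submod Z' B'.
Proof. by move=> /asboolP xB; apply/asboolP; exact: fB. Qed.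

Definition subquot_map : {linear subquot Z B -> subquot Z' B'} :=
  quot_map subquot_map_subproof.

End SubquotientMap.

(* Hom_R(M, X), with the pointwise module structure. *)
Section HomModule.
Variables (R : comNzRingType) (M X : lmodType R).
Implicit Types f g h : {linear M -> X}.

Lemma linear_ext f g : f =1 g -> f = g.
Proof.
case: f g => f [[fa] [fl]] [g [[ga] [gl]]] /= fg.
have {fg} fg : f = g by apply: funext.
case: g / fg ga gl => ga gl.
by rewrite (Prop_irrelevance fa ga) (Prop_irrelevance fl gl).
Qed.

HB.instance Definition _ := gen_eqMixin {linear M -> X}.
HB.instance Definition _ := gen_choiceMixin {linear M -> X}.

Definition hom_zero : {linear M -> X} := \0%R.
Definition hom_add f g : {linear M -> X} := f \+ g.
Definition hom_opp f : {linear M -> X} := \- f.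
Definition hom_scale (c : R) f : {linear M -> X} := c \*: f.

Fact hom_addA : associative hom_add.
Proof. by move=> f g h; apply: linear_ext => x /=; rewrite addrA. Qed.
Fact hom_addC : commutative hom_add.
Proof. by move=> f g; apply: linear_ext => x /=; rewrite addrC. Qed.
Fact hom_add0 : left_id hom_zero hom_add.
Proof. by move=> f; apply: linear_ext => x /=; rewrite add0r. Qed.
Fact hom_addN : left_inverse hom_zero hom_opp hom_add.
Proof. by move=> f; apply: linear_ext => x /=; rewrite addNr. Qed.

HB.instance Definition _ := GRing.isZmodule.Build {linear M -> X}
  hom_addA hom_addC hom_add0 hom_addN.

Fact hom_scaleA a b f : hom_scale a (hom_scale b f) = hom_scale (a * b) f.
Proof. by apply: linear_ext => x /=; rewrite scalerA. Qed.
Fact hom_scale1 : left_id 1 hom_scale.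
Proof. by move=> f; apply: linear_ext => x /=; rewrite scale1r. Qed.
Fact hom_scaleDr : right_distributive hom_scale +%R.
Proof. by move=> c f g; apply: linear_ext => x /=; rewrite scalerDr. Qed.
Fact hom_scaleDl f : {morph hom_scale^~ f : a b / a + b}.
Proof. by move=> a b; apply: linear_ext => x /=; rewrite scalerDl. Qed.

HB.instance Definition _ := GRing.Zmodule_isLmodule.Build R {linear M -> X}
  hom_scaleA hom_scale1 hom_scaleDr hom_scaleDl.

End HomModule.

Definition Hom_mod (R : comNzRingType) (M X : lmodType R) : lmodType R :=
  {linear M -> X}.

Section Precomp.
Variables (R : comNzRingType) (M N X : lmodType R) (f : {linear M -> N}).

Definition precomp (g : Hom_mod N X) : Hom_mod M X :=
  (g \o f : {linear M -> X}).

Fact precomp_linear : linear precomp.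
Proof. by move=> c g h; apply: linear_ext. Qed.
HB.instance Definition _ :=
  GRing.isLinear.Build R (Hom_mod N X) (Hom_mod M X) *:%R precomp
    precomp_linear.

End Precomp.
Arguments precomp {R M N} X f.

Section FreeModule.
Variables (R : nzRingType) (K : choiceType) (M : lmodType R) (f : K -> M).

Fact fglift_linear : linear (fglift f : {freeg K / R} -> M).
Proof.
move=> c x y; have liftB := lift_is_additive f.
have lift0 : fglift f 0 = 0 by rewrite -[X in fglift _ X](subrr 0) liftB subrr.
have liftN u : fglift f (- u) = - fglift f u.
  by rewrite -[- u]add0r liftB lift0 add0r.
have liftD u v : fglift f (u + v) = fglift f u + fglift f v.
  by rewrite -[v]opprK liftB !opprK liftN opprK.
have liftsum I (r : seq I) (F : I -> {freeg K / R}) :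
    fglift f (\sum_(i <- r) F i) = \sum_(i <- r) fglift f (F i).
  by elim: r => [|i r IHr]; rewrite ?big_nil ?big_cons ?liftD ?IHr.
rewrite liftD; congr (_ + _); rewrite -{2}[x]freeg_sumE.
rewrite {1}/GRing.scale /= /fgscale !liftsum scaler_sumr.
by apply: eq_bigr => z _; rewrite !liftU scalerA.
Qed.

Definition free_lift : {linear {freeg K / R} -> M} :=
  HB.pack (fglift f)
    (GRing.isLinear.Build R {freeg K / R} M *:%R (fglift f) fglift_linear).

Lemma free_liftU c x : free_lift << c *g x >> = c *: f x.
Proof. exact: liftU. Qed.

End FreeModule.

(* The standard functorial free resolution of N:  K_0 = N,
   P_i = free module on the underlying set of K_i,
   K_(i+1) = ker (P_i -> K_i),  and  d_i : P_(i+1) -> K_(i+1) -> P_i. *)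
Section Syzygy.
Variable R : nzRingType.
Implicit Types N : lmodType R.

Definition free_cover N : lmodType R := {freeg N / R}.

Definition cover_map N : {linear free_cover N -> N} :=
  free_lift (fun x : N => x).

Fact ker_submod_subproof (V W : lmodType R) (f : {linear V -> W}) :
  is_submod [set x | f x = 0].
Proof.
split=> [|c u v fu fv] /=; first exact: linear0.
by rewrite linearP fu fv scaler0 addr0.
Qed.
Definition ker_submod (V W : lmodType R) (f : {linear V -> W}) :
  submodClosed V := mk_submod (ker_submod_subproof f).

Definition syz1 N : lmodType R := submod_of (ker_submod (cover_map N)).

Fixpoint syz N (i : nat) : lmodType R :=
  if i is j.+1 then syz1 (syz N j) else N.

Definition res N (i : nat) : lmodType R := free_cover (syz N i).

Definition res_d N (i : nat) : {linear res N i.+1 -> res N i} :=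
  (val : {linear syz1 (syz N i) -> _}) \o cover_map (syz N i.+1).

Section Functoriality.
Variables (N N' : lmodType R) (f : {linear N -> N'}).

Definition cover_fmap : {linear free_cover N -> free_cover N'} :=
  free_lift (fun x : N => << f x >> : {freeg N' / R}).

Lemma cover_map_natural x : cover_map N' (cover_fmap x) = f (cover_map N x).
Proof.
rewrite -[x]freeg_sumE !linear_sum; apply: eq_bigr => z _.
rewrite [cover_fmap _]free_liftU [cover_map N _]free_liftU !linearZ.
by congr (_ *: _); rewrite [LHS]free_liftU scale1r.
Qed.

Fact syz1_map_subproof x :
  x \in ker_submod (cover_map N) -> cover_fmap x \in ker_submod (cover_map N').
Proof.
move=> /asboolP x0; apply/asboolP.
by rewrite /mkset cover_map_natural [X in f X]x0 linear0.
Qed.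

Definition syz1_map : {linear syz1 N -> syz1 N'} :=
  submod_map syz1_map_subproof.

End Functoriality.

Fixpoint syz_map N N' (f : {linear N -> N'}) (i : nat) :
    {linear syz N i -> syz N' i} :=
  if i is j.+1 return {linear syz N i -> syz N' i}
  then syz1_map (syz_map f j) else f.

Definition res_map N N' (f : {linear N -> N'}) (i : nat) :
  {linear res N i -> res N' i} := cover_fmap (syz_map f i).

Lemma res_map_d N N' (f : {linear N -> N'}) i x :
  res_map f i (res_d N i x) = res_d N' i (res_map f i.+1 x).
Proof.
by rewrite [RHS](congr1 val (cover_map_natural (syz_map f i.+1) x)).
Qed.

End Syzygy.

(* Ext^i_R(N, X) is the i-th cohomology of the complex Hom_R(P_i, X). *)
Section Ext.
Variables (R : comNzRingType) (X : lmodType R).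
Implicit Types N : lmodType R.

Definition cochain_d N (i : nat) :
    {linear Hom_mod (res N i) X -> Hom_mod (res N i.+1) X} :=
  precomp X (res_d N i).

Definition cocycles N (i : nat) : submodClosed (Hom_mod (res N i) X) :=
  ker_submod (cochain_d N i).

Definition coboundary_set N (i : nat) : set (Hom_mod (res N i) X) :=
  if i is j.+1 return set (Hom_mod (res N i) X)
  then range (cochain_d N j) else [set 0].

Fact coboundary_subproof N i : is_submod (@coboundary_set N i).
Proof.
case: i => [|i]; split=> //=.
- by move=> c u v -> ->; rewrite scaler0 addr0.
- by exists 0 => //; rewrite linear0.
- by move=> c _ _ [u _ <-] [v _ <-]; exists (c *: u + v); rewrite ?linearP.
Qed.

Definition coboundaries N (i : nat) : submodClosed (Hom_mod (res N i) X) :=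
  mk_submod (@coboundary_subproof N i).

Definition Ext (i : nat) N : lmodType R :=
  subquot (cocycles N i) (coboundaries N i).

Section Functoriality.
Variables (N N' : lmodType R) (f : {linear N -> N'}) (i : nat).

Lemma cochain_map_d j (g : Hom_mod (res N' j) X) :
  precomp X (res_map f j.+1) (cochain_d N' j g)
    = cochain_d N j (precomp X (res_map f j) g).
Proof.
apply: linear_ext => x.
change (g (res_d N' j (res_map f j.+1 x)) = g (res_map f j (res_d N j x))).
by rewrite res_map_d.
Qed.

Fact Ext_map_cocycles (g : Hom_mod (res N' i) X) :
  g \in cocycles N' i -> precomp X (res_map f i) g \in cocycles N i.
Proof.
move=> /asboolP g0; apply/asboolP.
by rewrite /mkset -cochain_map_d [X in precomp _ _ X]g0 linear0.
Qed.

Fact Ext_map_coboundaries (g : Hom_mod (res N' i) X) :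
  g \in coboundaries N' i -> precomp X (res_map f i) g \in coboundaries N i.
Proof.
move=> /asboolP gB; apply/asboolP; move: g gB.
case: i => [|j] g /= => [->|[h _ <-]]; first exact: linear0.
by exists (precomp X (res_map f j) h); rewrite // cochain_map_d.
Qed.

Definition Ext_map : {linear Ext i N' -> Ext i N} :=
  subquot_map Ext_map_cocycles Ext_map_coboundaries.

End Functoriality.

End Ext.

(* The direct limit of E_0 -> E_1 -> E_2 -> ...: the direct sum of the E_k
   (the finitely supported elements of their product) modulo the submodule
   generated by the elements x - f_k x with x in E_k. *)
Section DirectLimit.
Variables (R : pzRingType) (E : nat -> lmodType R).

Definition dprod : Type := forall k, E k.
HB.instance Definition _ := Choice.on dprod.

Definition dprod_zero : dprod := fun=> 0.
Definition dprod_add (x y : dprod) : dprod := fun k => x k + y k.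
Definition dprod_opp (x : dprod) : dprod := fun k => - x k.
Definition dprod_scale (c : R) (x : dprod) : dprod := fun k => c *: x k.

Lemma dprod_ext (x y : dprod) : (forall k, x k = y k) -> x = y.
Proof. exact: functional_extensionality_dep. Qed.

Fact dprod_addA : associative dprod_add.
Proof. by move=> x y z; apply: dprod_ext => k; apply: addrA. Qed.
Fact dprod_addC : commutative dprod_add.
Proof. by move=> x y; apply: dprod_ext => k; apply: addrC. Qed.
Fact dprod_add0 : left_id dprod_zero dprod_add.
Proof. by move=> x; apply: dprod_ext => k; apply: add0r. Qed.
Fact dprod_addN : left_inverse dprod_zero dprod_opp dprod_add.
Proof. by move=> x; apply: dprod_ext => k; apply: addNr. Qed.

HB.instance Definition _ := GRing.isZmodule.Build dprod
  dprod_addA dprod_addC dprod_add0 dprod_addN.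

Fact dprod_scaleA a b x :
  dprod_scale a (dprod_scale b x) = dprod_scale (a * b) x.
Proof. by apply: dprod_ext => k; apply: scalerA. Qed.
Fact dprod_scale1 : left_id 1 dprod_scale.
Proof. by move=> x; apply: dprod_ext => k; apply: scale1r. Qed.
Fact dprod_scaleDr : right_distributive dprod_scale +%R.
Proof. by move=> c x y; apply: dprod_ext => k; apply: scalerDr. Qed.
Fact dprod_scaleDl x : {morph dprod_scale^~ x : a b / a + b}.
Proof. by move=> a b; apply: dprod_ext => k; apply: scalerDl. Qed.

HB.instance Definition _ := GRing.Zmodule_isLmodule.Build R dprod
  dprod_scaleA dprod_scale1 dprod_scaleDr dprod_scaleDl.

Definition dsum_set : set dprod :=
  [set x | exists m, forall k, (m <= k)%N -> x k = 0].

Fact dsum_subproof : is_submod dsum_set.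
Proof.
split=> [|c u v [m um] [m' vm']]; first by exists 0%N.
exists (maxn m m') => k; rewrite geq_max => /andP[mk m'k].
transitivity (c *: u k + v k) => //.
by rewrite um// vm'// scaler0 addr0.
Qed.
Definition dsum : submodClosed dprod := mk_submod dsum_subproof.

Definition dinj (k : nat) (x : E k) : dprod := dfwith (fun j => 0 : E j) k x.

Variable f : forall k, {linear E k -> E k.+1}.

Definition dlim_rel : submodClosed dprod :=
  gen_submod [set z | exists k (x : E k), z = dinj x - dinj (f k x)].

Definition dlim : lmodType R := subquot dsum dlim_rel.

End DirectLimit.

(* [submod_mul I N] is the submodule I N of M; ideals act on R^o = R by
   multiplication, so I J is the case N = J. *)
Section IdealAction.
Variable R : nzRingType.

Definition submod_mul (M : lmodType R) (I : submodClosed R^o)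
    (N : submodClosed M) : submodClosed M :=
  gen_submod [set z | exists r x, [/\ r \in I, x \in N & z = r *: x]].

Fixpoint ideal_pow (I : submodClosed R^o) (k : nat) : submodClosed R^o :=
  if k is j.+1 then submod_mul I (ideal_pow I j) else full_submod R^o.

Definition ideal_act (I : submodClosed R^o) (M : lmodType R) :
  submodClosed M := submod_mul I (full_submod M).

Lemma ideal_pow_decr I k (r : R^o) :
  r \in ideal_pow I k.+1 -> r \in ideal_pow I k.
Proof.
move=> /asboolP /(_ (ideal_pow I k)); apply=> _ [c [x [_ xI ->]]].
exact: rpredZ.
Qed.

Lemma ideal_act_pow_decr I (M : lmodType R) k (x : M) :
  x \in ideal_act (ideal_pow I k.+1) M ->
  idfun x \in ideal_act (ideal_pow I k) M.
Proof.
move=> /asboolP Ix; apply/asboolP => S GS; apply: Ix.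
move=> _ [r [y [rI yM ->]]]; apply: GS.
by exists r, y; split=> //; apply: ideal_pow_decr.
Qed.

End IdealAction.

(* Generalized local cohomology; transition maps are induced by the
   projections M/I^(k+1) M -> M/I^k M. *)
Section LocalCohomology.
Variables (R : comNzRingType) (I : submodClosed R^o).

Definition pow_quot (M : lmodType R) (k : nat) : lmodType R :=
  quot_mod (ideal_act (ideal_pow I k) M).

Definition pow_quot_map (M : lmodType R) (k : nat) :
    {linear pow_quot M k.+1 -> pow_quot M k} :=
  quot_map (@ideal_act_pow_decr R I M k).

Definition gen_local_coh (i : nat) (M X : lmodType R) : lmodType R :=
  dlim (fun k => Ext_map X (pow_quot_map M k) i).

Definition local_coh (i : nat) (X : lmodType R) : lmodType R :=
  gen_local_coh i R^o X.

End LocalCohomology.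

Section AssociatedPrimes.
Variable R : comNzRingType.

Definition prime_ideal (p : set R) : Prop :=
  idealr_closed (mem p) /\ prime_idealr_closed (mem p).

Definition Ass (Y : lmodType R) : set (set R) :=
  [set p | prime_ideal p /\ exists y : Y, p = [set r | r *: y = 0]].

Definition weakly_laskerian (Y : lmodType R) : Prop :=
  forall S : submodClosed Y, finite_set (Ass (quot_mod S)).

End AssociatedPrimes.

(* Main.v *)
From HB Require Import structures.
Require Import Defs.
From mathcomp Require Import all_boot all_order all_algebra.
From mathcomp Require Import mathcomp_extra boolp classical_sets functions.
From mathcomp Require Import cardinality.
From mathcomp Require Import freeg.

Set Implicit Arguments.
Unset Strict Implicit.
Unset Printing Implicit Defensive.

Import GRing.Theory.
Local Open Scope ring_scope.
Local Open Scope classical_set_scope.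

(** Write h^i(N) for H^i_a(N, X), a contravariant functor of the finitely
    generated module N.  Weakly Laskerian modules are closed under submodules,
    quotients and extensions, so the theorem follows from two exactness
    properties of h.  For a short exact sequence 0 -> A -> B -> C -> 0 of
    finitely generated modules,
      - h^n(C) -> h^n(B) -> h^n(A) is exact ([glc_map_exact]);
      - the kernel of h^(n+1)(C) -> h^(n+1)(B) is weakly Laskerian as soon as
        h^n(A) is ([weakly_laskerian_ker_glc_map]), and h^0(C) -> h^0(B) is
        injective ([glc_map_inj0]).

    Both are limits of the long exact sequence of Ext in its first variable,
    applied for every k to 0 -> K_k -> B/a^k B -> C/a^k C -> 0.  Here K_k is
    A/(A meet a^k B) rather than A/a^k A, and the Artin-Rees lemma
    ([artin_rees]) says that the two inverse systems have the same limit of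
    Ext's.  The long exact sequence itself comes from the fact that the mapping
    cone of the resolutions of A and B is a projective resolution of C.

    Consequently h^i(N) is weakly Laskerian for all i < n and all finitely
    generated N ([weakly_laskerian_glc_below]): by induction on i one passes
    from N = R to cyclic modules R/I, at the cost of h^(i-1)(I), and from cyclic
    modules to all others by extensions.

    Now let H = h^n(M), let U = (0 :_H a), and let s_1, .., s_t generate a.  The
    map (m_j) |-> sum_j s_j m_j is a surjection of M^t onto aM, with kernel K.
    A class of U becomes zero in h^n(M^t), since each s_j kills it, so its
    restriction to aM lies in the kernel of h^n(aM) -> h^n(M^t), which is
    controlled by h^(n-1)(K).  The classes whose restriction to aM vanishes come
    from h^n(M/aM), which is a quotient of Ext^n(M/aM, X) because a kills M/aM.
    Hence U is weakly Laskerian ([weakly_laskerian_socle]).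

    Finally Hom(R/a, H) embeds in U by evaluation at 1, and since every class of
    H is killed by a power of a, an associated prime of H contains a and is
    therefore already an associated prime of U. *)

(** * Linear maps and submodules *)

Section LinearMaps.
Variable R : comNzRingType.
Implicit Types U V W : lmodType R.

Definition mk_linear U V (f : U -> V) (fl : linear f) : {linear U -> V} :=
  HB.pack f (GRing.isLinear.Build R U V *:%R f fl).

(** The main device for building a linear map out of a module whose elements are
    only known as images: choose preimages, and let the kernel condition absorb
    the choice. *)
Lemma linear_factor U V W (p : {linear V -> W}) (q : {linear V -> U}) :
  (forall w, exists v, p v = w) -> (forall v, p v = 0 -> q v = 0) ->
  exists r : {linear W -> U}, forall v, r (p v) = q v.
Proof.
move=> p_surj ker_pq; pose s w := sval (cid (p_surj w)).
have sK w : p (s w) = w by rewrite /s; case: cid.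
have qE v v' : p v = p v' -> q v = q v'.
  move=> pvv'; apply/eqP; rewrite -subr_eq0 -linearB; apply/eqP/ker_pq.
  by rewrite linearB pvv' subrr.
have ql : linear (q \o s).
  by move=> c x y /=; rewrite -linearP; apply: qE; rewrite linearP !sK.
by exists (mk_linear ql) => v; apply: qE; rewrite sK.
Qed.

Lemma submodN V (S : submodClosed V) x : x \in S -> - x \in S.
Proof. by move=> xS; rewrite -scaleN1r rpredZ. Qed.

Lemma submodB V (S : submodClosed V) x y : x \in S -> y \in S -> x - y \in S.
Proof. by move=> xS yS; rewrite rpredD ?submodN. Qed.

Fact preim_submod_subproof U V (f : {linear U -> V}) (S : submodClosed V) :
  is_submod [set x | f x \in S].
Proof.
split=> [|c u v fu fv] /=; first by rewrite linear0 rpred0.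
by rewrite linearP rpredD ?rpredZ.
Qed.
Definition preim_submod U V (f : {linear U -> V}) S : submodClosed U :=
  mk_submod (preim_submod_subproof f S).

Fact im_submod_subproof U V (f : {linear U -> V}) (S : submodClosed U) :
  is_submod [set y | exists2 x, x \in S & y = f x].
Proof.
split=> [|c _ _ [x xS ->] [y yS ->]] /=.
  by exists 0; rewrite ?rpred0 ?linear0.
by exists (c *: x + y); rewrite ?linearP// rpredD ?rpredZ.
Qed.
Definition im_submod U V (f : {linear U -> V}) S : submodClosed V :=
  mk_submod (im_submod_subproof f S).

Lemma in_preim U V (f : {linear U -> V}) (S : submodClosed V) x :
  (x \in preim_submod f S) = (f x \in S).
Proof. exact: asboolb. Qed.

Lemma in_imP U V (f : {linear U -> V}) (S : submodClosed U) y :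
  reflect (exists2 x, x \in S & y = f x) (y \in im_submod f S).
Proof. exact: asboolP. Qed.

Lemma im_in U V (f : {linear U -> V}) (S : submodClosed U) x :
  x \in S -> f x \in im_submod f S.
Proof. by move=> xS; apply/in_imP; exists x. Qed.

Lemma in_ker U V (f : {linear U -> V}) x : (x \in ker_submod f) = (f x == 0).
Proof. by apply/asboolP/eqP. Qed.

Lemma quot_proj_eq0 V (S : submodClosed V) x : quot_proj S x = 0 <-> x \in S.
Proof.
rewrite -(linear0 (quot_proj S)); split=> [/eqP|xS]; last apply/eqP.
  by rewrite quot_projP subr0.
by rewrite quot_projP subr0.
Qed.

Lemma mem_full V (x : V) : x \in full_submod V.
Proof. exact/asboolP. Qed.

End LinearMaps.

(** * Weakly Laskerian modules form a Serre class *)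

Section Serre.
Variable R : comNzRingType.
Implicit Types (Y Z : lmodType R) (p : set R).

(** For the class of [y] in the quotient by [S] this is its annihilator, which
    lets the associated primes of quotients be handled inside [Y]. *)
Definition colon Y (S : submodClosed Y) (y : Y) : set R :=
  [set r | r *: y \in S].

Lemma prime_idealM p u v : prime_ideal p -> p (u * v) -> p u \/ p v.
Proof.
move=> [_ pM] /mem_set /pM /orP[] /set_mem; [left | right] => //.
Qed.

Lemma Ass_quot Y (S : submodClosed Y) :
  Ass (quot_mod S) = [set p | prime_ideal p /\ exists y, p = colon S y].
Proof.
have E y : [set r : R | r *: quot_proj S y = 0] = colon S y.
  by apply/seteqP; split=> r; rewrite /colon /mkset -[_ *: quot_proj S y]linearZ;
    move=> /quot_proj_eq0.
apply/seteqP; split=> p [pp [y py]]; split=> //.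
- by exists (repr y); rewrite py -E quot_projK.
- by exists (quot_proj S y); rewrite E.
Qed.

Lemma weakly_laskerian_inj Y Z (f : {linear Y -> Z}) :
  (forall y, f y = 0 -> y = 0) -> weakly_laskerian Z -> weakly_laskerian Y.
Proof.
move=> f_inj WZ S; apply: sub_finite_set (WZ (im_submod f S)).
rewrite !Ass_quot => p [pp [y py]]; split=> //; exists (f y).
rewrite py; apply/seteqP; split=> r; rewrite /colon /mkset.
  by move=> ryS; rewrite -linearZ im_in.
move=> /in_imP[x xS /eqP]; rewrite -linearZ -subr_eq0 -linearB => /eqP/f_inj/eqP.
by rewrite subr_eq0 => /eqP->.
Qed.

Lemma weakly_laskerian_surj Y Z (f : {linear Y -> Z}) :
  (forall z, exists y, f y = z) -> weakly_laskerian Y -> weakly_laskerian Z.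
Proof.
move=> f_surj WY S; apply: sub_finite_set (WY (preim_submod f S)).
rewrite !Ass_quot => p [pp [z pz]]; split=> //.
have [y fy] := f_surj z; exists y; rewrite pz -fy.
by apply/seteqP; split=> r; rewrite /colon /mkset in_preim linearZ.
Qed.

(** Let p = (S : y) be an associated prime of Y/S.  If some r outside p brings
    r y into S + ker f, then r y is congruent modulo S to an element of ker f,
    whose annihilator is still p because p is prime; otherwise (f S : f y) = p.
    So p is associated to a quotient of ker f or to a quotient of Z. *)
Lemma weakly_laskerian_ext Y Z (f : {linear Y -> Z}) :
  weakly_laskerian (submod_of (ker_submod f)) -> weakly_laskerian Z ->
  weakly_laskerian Y.
Proof.
move=> WK WZ S; pose K := submod_of (ker_submod f).
pose i : {linear K -> Y} := val.
have := WZ (im_submod f S); have := WK (preim_submod i S).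
rewrite !Ass_quot => fK fZ; apply: (sub_finite_set _ (_ : finite_set (_ `|` _))).
  2: by rewrite finite_setU; split; [exact: fK|exact: fZ].
move=> p [pp [y py]].
have [[r [nr rim]]|H] := pselect (exists r, ~ p r /\ f (r *: y) \in im_submod f S).
- left; split=> //; case/in_imP: rim => s sS /eqP.
  rewrite -subr_eq0 -linearB -in_ker => kP.
  exists (Sub (r *: y - s) kP); rewrite {1}py.
  have E u : i (u *: (Sub (r *: y - s) kP : K)) = u *: (r *: y - s) by [].
  apply/seteqP; split=> u; rewrite /colon /mkset in_preim E => uy.
    rewrite scalerBr; apply: submodB; last exact: rpredZ.
    by rewrite scalerA mulrC -scalerA; apply: rpredZ.
  have : p (u * r).
    rewrite py /colon /mkset -scalerA -[r *: y](subrK s) scalerDr rpredD//.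
    exact: rpredZ.
  by case/(prime_idealM pp) => //; rewrite py.
- right; split=> //; exists (f y); apply/seteqP; split=> r; rewrite /colon /mkset.
    by rewrite {1}py -linearZ => ?; apply: im_in.
  by move=> rf; apply: contrapT => nr; apply: H; exists r; rewrite linearZ.
Qed.

Lemma finite_Ass_weakly_laskerian Y : weakly_laskerian Y -> finite_set (Ass Y).
Proof.
have H0 : is_submod [set 0 : Y].
  by split=> // c u v -> ->; rewrite /= scaler0 addr0.
move=> /(_ (mk_submod H0)); apply: sub_finite_set.
rewrite Ass_quot => p [pp [y py]]; split=> //; exists y; rewrite py.
apply/seteqP; split=> r; rewrite /colon /mkset.
  by move=> ry; apply/asboolP.
by move=> /asboolP.
Qed.

End Serre.

(** * Noetherian modules *)

Section Noetherian.
Variable R : comNzRingType.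
Implicit Types V W : lmodType R.

Lemma mem_gen V (G : set V) g : G g -> g \in gen_submod G.
Proof. by move=> Gg; apply/asboolP => S; apply. Qed.

Lemma gen_subP V (G : set V) (S : submodClosed V) :
  (forall g, G g -> g \in S) -> forall x, x \in gen_submod G -> x \in S.
Proof. by move=> GS x /asboolP; apply. Qed.

Lemma gen_sub V (G H : set V) x :
  G `<=` H -> x \in gen_submod G -> x \in gen_submod H.
Proof. by move=> GH; apply: gen_subP => g /GH; exact: mem_gen. Qed.

Definition noetherian_module V : Prop := forall S : submodClosed V, fg_submod S.

(** This peels one generator off, which is what an induction on the number of
    generators needs. *)
Lemma gen_consP V (y : V) (s : seq V) x :
  x \in gen_submod [set` y :: s] -> exists r, x - r *: y \in gen_submod [set` s].
Proof.
have H : is_submod [set x | exists r, x - r *: y \in gen_submod [set` s]].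
  split=> [|c u v [a au] [b bv]].
    by exists 0; rewrite scale0r subr0; apply: rpred0.
  exists (c * a + b); rewrite scalerDl -scalerA opprD addrACA -scalerBr.
  by apply: rpredD => //; apply: rpredZ.
move=> xG; apply/asboolP; rewrite -[`[< _ >]]/(x \in mk_submod H).
apply: gen_subP xG => g; rewrite /mkset inE => /orP[/eqP->|gs]; apply/asboolP.
  by exists 1; rewrite scale1r subrr rpred0.
by exists 0; rewrite scale0r subr0; apply: mem_gen.
Qed.

(** Induction on the number of generators.  The coefficients of y in the
    elements of S form an ideal; lifts to S of finitely many generators of this
    ideal, together with generators of the part of S that avoids y, generate
    S. *)
Lemma fg_sub_of_gen V (s : seq V) (S : submodClosed V) :
  noetherian_ring R -> (forall x, x \in S -> x \in gen_submod [set` s]) ->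
  fg_submod S.
Proof.
move=> Rn; elim: s S => [|y s IHs] S Ss.
  exists [::] => x; apply/idP/idP => [/Ss //|]; exact: gen_subP.
have HT : is_submod [set x | x \in S /\ x \in gen_submod [set` s]].
  split=> [|c u v [uS us] [vS vs]]; first by split; rewrite rpred0.
  by split; apply: rpredD => //; apply: rpredZ.
pose good (r : R^o) v := v \in S /\ v - (r : R) *: y \in gen_submod [set` s].
have HJ : is_submod [set r : R^o | exists v, good r v].
  split=> [|c a b [u [uS us]] [v [vS vs]]].
    by exists 0; split; rewrite ?scale0r ?subr0; apply: rpred0.
  exists (c *: u + v); split; first by apply: rpredD => //; apply: rpredZ.
  rewrite scalerDl -scalerA opprD addrACA -scalerBr.
  by apply: rpredD => //; apply: rpredZ.
have [t tT] := IHs (mk_submod HT) (fun x (xT : x \in mk_submod HT) =>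
  proj2 (asboolW xT)).
have [rs rsJ] := Rn (mk_submod HJ).
have Jgood (r : R^o) : exists v, r \in mk_submod HJ -> good r v.
  have [/asboolP[v gv]|nr] := boolP (r \in mk_submod HJ); first by exists v.
  by exists 0.
pose f (r : R^o) := sval (cid (Jgood r)).
have fP r : r \in mk_submod HJ -> good r (f r) by rewrite /f; case: cid.
pose vs := map f rs.
have vsS g : g \in vs -> g \in S.
  by case/mapP => r rrs ->; case: (fP r) => //; rewrite rsJ; apply: mem_gen.
exists (vs ++ t) => x; apply/idP/idP => [xS|]; last first.
  apply: gen_subP => g /=; rewrite mem_cat => /orP[/vsS //|gt].
  have /asboolP[] // : g \in mk_submod HT by rewrite tT; apply: mem_gen.
have [r xr] := gen_consP (Ss x xS).
have rJ : (r : R^o) \in gen_submod [set` rs].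
  by rewrite -rsJ; apply/asboolP; exists x.
have HL : is_submod [set r : R^o | exists2 v, v \in gen_submod [set` vs] &
                        good r v].
  split=> [|c a b [u uv [uS us]] [v vv [vS vs']]].
    by exists 0; [|split]; rewrite ?scale0r ?subr0; apply: rpred0.
  exists (c *: u + v); first by apply: rpredD => //; apply: rpredZ.
  split; first by apply: rpredD => //; apply: rpredZ.
  rewrite scalerDl -scalerA opprD addrACA -scalerBr.
  by apply: rpredD => //; apply: rpredZ.
have /asboolP[v vvs [vS vr]] : (r : R^o) \in mk_submod HL.
  apply: gen_subP rJ => g /= grs; apply/asboolP; exists (f g).
    by apply: mem_gen; apply: map_f.
  by apply: fP; rewrite rsJ; apply: mem_gen.
rewrite -[x](subrK v) addrC; apply: rpredD.
  by apply: gen_sub vvs => g /= gv; rewrite mem_cat gv.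
have : x - v \in mk_submod HT.
  apply/asboolP; split; first exact: submodB.
  by have := submodB xr vr; rewrite opprB addrA subrK.
by rewrite tT; apply: gen_sub => g /= gv; rewrite mem_cat gv orbT.
Qed.

Lemma fg_noetherian V : noetherian_ring R -> fg_module V -> noetherian_module V.
Proof.
move=> Rn [s sV] S; apply: (fg_sub_of_gen (s := s)) => // x _.
by rewrite -sV; apply/asboolP.
Qed.

(** The union of the chain is finitely generated, and its generators all lie in
    one term of the chain. *)
Lemma noetherian_chain V (N : nat -> submodClosed V) : noetherian_module V ->
  (forall i x, x \in N i -> x \in N i.+1) ->
  exists i, forall k x, x \in N k -> x \in N i.
Proof.
move=> Vn Nup.
have Nle i j x : (i <= j)%N -> x \in N i -> x \in N j.
  move=> /subnK <-; elim: (j - i)%N => // d IH /IH; exact: Nup.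
have HU : is_submod [set x | exists i, x \in N i].
  split=> [|c u v [i ui] [j vj]]; first by exists 0%N; rewrite rpred0.
  exists (maxn i j); apply: rpredD; first apply: rpredZ.
    exact: (Nle i _ _ (leq_maxl _ _)).
  exact: (Nle j _ _ (leq_maxr _ _)).
have [s sU] := Vn (mk_submod HU).
have [i si] : exists i, forall x, x \in s -> x \in N i.
  have : forall x, x \in s -> exists i, x \in N i.
    move=> x xs; have /asboolP// : x \in mk_submod HU by rewrite sU; apply: mem_gen.
  elim: {sU} s => [|y s IH] ys; first by exists 0%N.
  have [i ui] := ys y (mem_head _ _).
  have [x xs|j sj] := IH; first by apply: ys; rewrite inE xs orbT.
  exists (maxn i j) => x; rewrite inE => /orP[/eqP->|/sj].
    exact: (Nle i _ _ (leq_maxl _ _)).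
  exact: (Nle j _ _ (leq_maxr _ _)).
exists i => k x xk.
have : x \in mk_submod HU by apply/asboolP; exists k.
by rewrite sU; apply: gen_subP.
Qed.

(** Without a maximal element one could choose a strictly increasing sequence,
    contrary to [noetherian_chain]. *)
Lemma noetherian_max V (P : submodClosed V -> Prop) S0 : noetherian_module V ->
  P S0 -> exists S, P S /\ forall T, P T ->
    (forall x, x \in S -> x \in T) -> forall x, x \in T -> x \in S.
Proof.
move=> Vn PS0; apply: contrapT => noS.
have step (S : {S | P S}) : exists T : {S | P S},
    (forall x, x \in sval S -> x \in sval T) /\
    exists2 x, x \in sval T & x \notin sval S.
  case: S => S PS; apply: contrapT => H; apply: noS; exists S; split=> // T PT ST.
  move=> x xT; apply: contrapT => /negP xS; apply: H.
  by exists (exist _ T PT); split=> //; exists x.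
pose N := fix N i : {S | P S} :=
  if i is j.+1 then sval (cid (step (N j))) else exist _ S0 PS0.
have NS i : (forall x, x \in sval (N i) -> x \in sval (N i.+1)) /\
    exists2 x, x \in sval (N i.+1) & x \notin sval (N i).
  by rewrite /=; case: cid.
have [i Ni] := noetherian_chain (N := fun i => sval (N i)) Vn
  (fun i => (NS i).1).
by have [_ [x /Ni ->]] := NS i.
Qed.

End Noetherian.

(** * The Artin-Rees lemma *)

Section ArtinRees.
Variable R : comNzRingType.
Implicit Types (V : lmodType R) (a I : submodClosed R^o).

Lemma mem_smul V I (N : submodClosed V) (r : R) x :
  (r : R^o) \in I -> x \in N -> r *: x \in submod_mul I N.
Proof. by move=> rI xN; apply: mem_gen; exists r, x. Qed.

Lemma smul_subP V I (N S : submodClosed V) :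
  (forall (r : R) x, (r : R^o) \in I -> x \in N -> r *: x \in S) ->
  forall x, x \in submod_mul I N -> x \in S.
Proof. by move=> H; apply: gen_subP => _ [r [x [rI xN ->]]]; apply: H. Qed.

Lemma mem_act V I (r : R) (x : V) : (r : R^o) \in I -> r *: x \in ideal_act I V.
Proof. by move=> rI; apply: mem_smul (mem_full x). Qed.

Lemma act_subP V I (S : submodClosed V) :
  (forall (r : R) x, (r : R^o) \in I -> r *: x \in S) ->
  forall x, x \in ideal_act I V -> x \in S.
Proof. by move=> H; apply: smul_subP => r x rI _; apply: H. Qed.

Lemma ideal_pow_leq a i j r :
  (i <= j)%N -> r \in ideal_pow a j -> r \in ideal_pow a i.
Proof.
by move=> /subnK <-; elim: (j - i)%N => // d IH rd; apply/IH/ideal_pow_decr.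
Qed.

Lemma expr_ideal_pow a (r : R) i :
  (r : R^o) \in a -> (r ^+ i : R^o) \in ideal_pow a i.
Proof.
move=> ra; elim: i => [|i IH]; first exact: mem_full.
by rewrite exprS; apply: (mem_smul ra IH).
Qed.

(** If each element of a finitely generated ideal acts nilpotently on V/N, then
    so does the ideal.  A maximal counterexample N would have, for each
    generator r, either (N : r) = N, which together with nilpotency of r forces
    N = V, or (N : r) strictly larger, hence swallowing some a^m V; then
    a^(m+1) V lies in N for m large enough. *)
Lemma nilpotent_mod V a (N : submodClosed V) : noetherian_module V -> fg_submod a ->
  (forall r : R, (r : R^o) \in a -> exists i, forall x : V, r ^+ i *: x \in N) ->
  exists m, forall x, x \in ideal_act (ideal_pow a m) V -> x \in N.
Proof.
move=> Vn [s sa] aN; apply: contrapT => noN.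
pose nil (S : submodClosed V) :=
  exists m, forall x, x \in ideal_act (ideal_pow a m) V -> x \in S.
pose P (S : submodClosed V) := (forall r : R, (r : R^o) \in a ->
  exists i, forall x : V, r ^+ i *: x \in S) /\ ~ nil S.
have [{aN noN}N [[aN noN] Nmax]] : exists S, P S /\ forall T, P T ->
    (forall x, x \in S -> x \in T) -> forall x, x \in T -> x \in S.
  exact: (noetherian_max (S0 := N)).
apply: noN; have memE (r : R) (x : V) :
    (x \in preim_submod ( *:%R r) N) = (r *: x \in N) by exact: in_preim.
have colon_nil (r : R) : (r : R^o) \in a -> nil (preim_submod ( *:%R r) N).
  move=> ra; apply: contrapT => nonil; have NsubC (x : V) :
      x \in N -> x \in preim_submod ( *:%R r) N.
    by move=> xN; rewrite memE rpredZ.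
  have CsubN := Nmax _ (conj _ nonil) NsubC.
  case: nonil; exists 0%N => x _; apply: NsubC.
  have [i ri] := aN r ra.
  elim: i x {ri}(ri x) => [|i IH] x; first by rewrite scale1r.
  rewrite exprS -scalerA => rx; apply/IH/CsubN.
    by move=> u /aN[k uk]; exists k => y; rewrite memE rpredZ.
  by rewrite memE.
have [m mN] : exists m, forall r : R, (r : R^o) \in s ->
    forall x, x \in ideal_act (ideal_pow a m) V -> r *: x \in N.
  have sa' (r : R^o) : r \in s -> r \in a by move=> rs; rewrite sa mem_gen.
  elim: {sa} s sa' => [|u s IH] sa'; first by exists 0%N.
  have [m um] := colon_nil u (sa' u (mem_head _ _)).
  have [|m' sm'] := IH; first by move=> r rs; apply: sa'; rewrite inE rs orbT.
  have actle i j (x : V) : (i <= j)%N -> x \in ideal_act (ideal_pow a j) V ->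
      x \in ideal_act (ideal_pow a i) V.
    by move=> ij; apply: act_subP => r y rj; apply/mem_act/(ideal_pow_leq ij).
  exists (maxn m m') => r; rewrite inE => /orP[/eqP-> x xm|rs x xm].
    by rewrite -memE; apply: um; apply: actle xm; apply: leq_maxl.
  by apply: sm' => //; apply: actle xm; apply: leq_maxr.
exists m.+1; apply: act_subP => r x rm.
have HS : is_submod [set r : R^o | forall x : V, (r : R) *: x \in N].
  split=> [y|c u v uN vN y]; first by rewrite scale0r rpred0.
  by rewrite scalerDl -scalerA rpredD// rpredZ.
suff /asboolP : r \in mk_submod HS by apply.
apply: smul_subP rm => {x} u v ua vm.
have HT : is_submod [set u : R^o | forall x : V, ((u : R) * v) *: x \in N].
  split=> [y|c w z wN zN y]; first by rewrite mul0r scale0r rpred0.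
  by rewrite mulrDl scalerDl -mulrA -scalerA rpredD// rpredZ.
suff /asboolP uT : u \in mk_submod HT by apply/asboolP => y; exact: uT.
move: ua; rewrite sa; apply: gen_subP => g gs; apply/asboolP => y.
by rewrite -scalerA; apply: mN => //; apply: mem_act.
Qed.

(** This is the weak form: the a-adic topology of A is the one induced from V.
    Take N maximal among the submodules that contain B = a^j A and meet A in B.
    For r in a the chain (N : r^i) stabilizes, and with k large the submodule
    N + r^k V still meets A in B: an element e = r^k b + n of A has r^k e in B,
    so r^(2k) b is in N, hence so is r^k b.  By maximality r^k V lies in N, and
    [nilpotent_mod] gives a power of a that maps V into N. *)
Lemma artin_rees V (A : submodClosed V) a j :
  noetherian_module V -> fg_submod a ->
  exists m, forall x, x \in A -> x \in ideal_act (ideal_pow a m) V ->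
    x \in submod_mul (ideal_pow a j) A.
Proof.
move=> Vn afg; pose B := submod_mul (ideal_pow a j) A.
pose P (S : submodClosed V) := (forall x, x \in B -> x \in S) /\
  forall x, x \in S -> x \in A -> x \in B.
have [|N [[BN NA] Nmax]] := noetherian_max (P := P) (S0 := B) Vn; first by split.
have [|m mN] := nilpotent_mod (N := N) Vn afg; last first.
  by exists m => x xA xm; apply: NA => //; apply: mN.
move=> r ra; pose C i : submodClosed V := preim_submod ( *:%R (r ^+ i)) N.
have memC i x : (x \in C i) = (r ^+ i *: x \in N) by exact: in_preim.
have [i Ci] : exists i, forall k x, x \in C k -> x \in C i.
  apply: noetherian_chain => // i x; rewrite !memC exprS -scalerA; exact: rpredZ.
(* At least i, so that (N : r^k) is stable, and at least j, so that r^k A is in B. *)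
pose k := (i + j)%N.
have Ck x : r ^+ (k + k) *: x \in N -> r ^+ k *: x \in N.
  rewrite -memC => /Ci; rewrite memC => ?.
  by rewrite /k addnC exprD -scalerA rpredZ.
have HT : is_submod [set x | exists b, x - r ^+ k *: b \in N].
  split=> [|c u v [b ub] [b' vb']]; first by exists 0; rewrite scaler0 subr0 rpred0.
  exists (c *: b + b'); rewrite scalerDr scalerA mulrC -scalerA opprD addrACA.
  by rewrite -scalerBr rpredD// rpredZ.
exists k => b; apply: (Nmax (mk_submod HT)); last first.
- by apply/asboolP; exists b; rewrite subrr rpred0.
- by move=> x xN; apply/asboolP; exists 0; rewrite scaler0 subr0.
split=> [x /BN xN|e /asboolP[{}b eb] eA].
  by apply/asboolP; exists 0; rewrite scaler0 subr0.
apply: NA => //.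
have rb : r ^+ k *: b \in N.
  apply: Ck; rewrite exprD -scalerA.
  have : r ^+ k *: e \in N.
    apply: BN; rewrite /k addnC exprD; apply: (mem_smul _ eA).
    by rewrite mulrC; apply: rpredZ; apply: expr_ideal_pow.
  move=> re; have /(submodB re) : r ^+ k *: (e - r ^+ k *: b) \in N.
    exact: rpredZ.
  by rewrite scalerBr opprB addrC subrK.
by rewrite -[e](subrK (r ^+ k *: b)) rpredD.
Qed.

End ArtinRees.

(** * Augmented complexes and the comparison theorem *)

Section Complexes.
Variable R : comNzRingType.
Implicit Types (U V W N : lmodType R).

(** The lifting property is asked only along the image of [p], so that it applies
    to the differentials of an exact complex, which are not surjective. *)
Definition projective (P : lmodType R) : Prop :=
  forall V W (p : {linear V -> W}) (q : {linear P -> W}),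
    (forall x, exists v, p v = q x) ->
  exists r : {linear P -> V}, forall x, p (r x) = q x.

Lemma freeg_linear_ext (K : choiceType) V (f g : {linear {freeg K / R} -> V}) :
  (forall k, f << k >> = g << k >>) -> f =1 g.
Proof.
move=> fg x; rewrite -[x]freeg_sumE !linear_sum; apply: eq_bigr => z _.
have -> : << coeff z x *g z >> = coeff z x *: << z >> :> {freeg K / R}.
  by apply/eqP/freeg_eqP => y; rewrite coeffZ !coeffU mul1r.
by rewrite !linearZ fg.
Qed.

Lemma free_liftE (K : choiceType) V (f : K -> V) k : free_lift f << k >> = f k.
Proof. by rewrite [LHS]free_liftU scale1r. Qed.

Lemma projective_free (K : choiceType) : projective {freeg K / R}.
Proof.
move=> V W p q pq; pose b k := sval (cid (pq << k >>)).
exists (free_lift b); apply: (@freeg_linear_ext _ _ (p \o free_lift b)) => k.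
change (p (free_lift b << k >>) = q << k >>).
by rewrite free_liftE /b; case: cid.
Qed.

Lemma projective_pair U V : projective U -> projective V ->
  projective (U * V)%type.
Proof.
move=> Up Vp V' W p q pq.
have iUl : linear (fun u : U => (u, 0) : (U * V)%type).
  by move=> c x y; congr pair; rewrite /= scaler0 addr0.
have iVl : linear (fun v : V => (0, v) : (U * V)%type).
  by move=> c x y; congr pair; rewrite /= scaler0 addr0.
have [rU rUE] := Up _ _ p (q \o mk_linear iUl) (fun u => pq _).
have [rV rVE] := Vp _ _ p (q \o mk_linear iVl) (fun u => pq _).
exists ((rU \o fst) \+ (rV \o snd)) => -[u v] /=.
by rewrite linearD rUE rVE /= -linearD; congr (q _); congr pair;
  rewrite ?addr0 ?add0r.
Qed.

Lemma dependent_choice (S : nat -> Type) (rel : forall i, S i -> S i.+1 -> Prop)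
    (s0 : S 0%N) :
  (forall i s, exists s', @rel i s s') ->
  exists s : forall i, S i, s 0%N = s0 /\ forall i, rel i (s i) (s i.+1).
Proof.
move=> step.
pose s := fix s i : S i :=
  if i is j.+1 return S i then sval (cid (step j (s j))) else s0.
by exists s; split=> // i; rewrite /=; case: cid.
Qed.

(** The augmentation is part of the complex: degree 0 is the resolved module, and
    degree i + 1 is the i-th term of the resolution.  Hence cohomology in degree n
    is carried by maps out of degree n + 1. *)
Record acomplex := AComplex {
  ac :> nat -> lmodType R;
  acd : forall i, {linear ac i.+1 -> ac i} }.

(** Everything in degree 0 is a cycle, so exactness there is surjectivity of the
    augmentation. *)
Definition is_cycle (C : acomplex) i : C i -> Prop :=
  if i is j.+1 return C i -> Prop then fun x => acd C j x = 0 else fun=> True.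

Definition is_complex (C : acomplex) : Prop :=
  forall i (x : C i.+1), is_cycle (acd C i x).

Definition exact_complex (C : acomplex) : Prop :=
  forall i (x : C i), is_cycle x -> exists y, acd C i y = x.

Definition projective_complex (C : acomplex) : Prop :=
  forall i, projective (C i.+1).

Definition chain_map (C T : acomplex) (u : forall i, {linear C i -> T i}) : Prop :=
  forall i x, acd T i (u i.+1 x) = u i (acd C i x).

Lemma chain_map_comp (C T S : acomplex) (u : forall i, {linear C i -> T i})
    (v : forall i, {linear T i -> S i}) :
  chain_map u -> chain_map v -> chain_map (fun i => v i \o u i).
Proof. by move=> uc vc i x; rewrite /= vc uc. Qed.

(** Each component is lifted through the exactness of T; the invariant carried by
    the recursion is that the last component sends boundaries to cycles. *)
Lemma chain_lift (C T : acomplex) (f : {linear C 0%N -> T 0%N}) :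
  is_complex C -> projective_complex C -> exact_complex T ->
  exists u : forall i, {linear C i -> T i}, u 0%N = f /\ chain_map u.
Proof.
move=> Cc Cp Te.
pose S i := {u : {linear C i -> T i} | forall x, is_cycle (u (acd C i x))}.
pose rel i (u : S i) (u' : S i.+1) :=
  forall x, acd T i (sval u' x) = sval u (acd C i x).
have [|s [s0 sE]] := @dependent_choice S rel (exist _ f (fun=> I)); last first.
  by exists (fun i => sval (s i)); split; [rewrite s0 | exact: sE].
move=> i [u uP]; rewrite /rel /=.
have [u' u'E] := Cp i _ _ (acd T i) (u \o acd C i) (fun x => Te i _ (uP x)).
have u'P x : is_cycle (u' (acd C i.+1 x)).
  by rewrite /= u'E /= [acd C i _](Cc i.+1 x) linear0.
by exists (exist _ u' u'P).
Qed.

(** Degree by degree: what remains of [w] after subtracting the part of the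
    homotopy already built is a cycle of T, hence a boundary. *)
Lemma chain_homotopy (C T : acomplex) (w : forall i, {linear C i -> T i}) :
  is_complex C -> projective_complex C -> exact_complex T -> chain_map w ->
  (forall x, w 0%N x = 0) ->
  exists s : forall i, {linear C i -> T i.+1}, (forall x, s 0%N x = 0) /\
    forall i x, w i.+1 x = acd T i.+1 (s i.+1 x) + s i (acd C i x).
Proof.
move=> Cc Cp Te wc w0.
pose S i := {s : {linear C i -> T i.+1} |
  forall x, acd T i (s (acd C i x)) = w i (acd C i x)}.
pose rel i (s : S i) (s' : S i.+1) :=
  forall x, w i.+1 x = acd T i.+1 (sval s' x) + sval s (acd C i x).
have s0P x : acd T 0%N ((\0 : {linear C 0%N -> T 1%N}) (acd C 0%N x)) =
    w 0%N (acd C 0%N x).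
  by rewrite linear0 w0.
have [|s [s0 sE]] := @dependent_choice S rel (exist _ _ s0P); last first.
  by exists (fun i => sval (s i)); split; [rewrite s0 | exact: sE].
move=> i [s sP]; rewrite /rel /=.
have [|s' s'E] := Cp i _ _ (acd T i.+1) (w i.+1 \- (s \o acd C i)).
  by move=> x; apply: Te; rewrite /= linearB sP wc subrr.
have s'P x : acd T i.+1 (s' (acd C i.+1 x)) = w i.+1 (acd C i.+1 x).
  by rewrite s'E /= [acd C i _](Cc i.+1 x) linear0 subr0.
by exists (exist _ s' s'P) => x; rewrite /= s'E /= subrK.
Qed.

Variable X : lmodType R.

Definition cocycle (C : acomplex) n (z : {linear C n.+1 -> X}) : Prop :=
  forall x, z (acd C n.+1 x) = 0.

(** For n = 0 the degree-n component of the complex is the resolved module, which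
    is not a term of the resolution, so no cochain may be used there. *)
Definition coboundary (C : acomplex) n (z : {linear C n.+1 -> X}) : Prop :=
  exists y : {linear C n -> X}, (n = 0%N -> forall x, y x = 0) /\
    forall x, z x = y (acd C n x).

(** All later comparisons of Ext classes go through this: a cocycle may be pulled
    back along any chain map that has the right degree-0 component. *)
Lemma chain_map_unique (C T : acomplex) (u v : forall i, {linear C i -> T i})
    n (z : {linear T n.+1 -> X}) :
  is_complex C -> projective_complex C -> exact_complex T ->
  chain_map u -> chain_map v -> u 0%N =1 v 0%N -> cocycle z ->
  coboundary ((z \o u n.+1) \- (z \o v n.+1)).
Proof.
move=> Cc Cp Te uc vc uv0 zc.
have [||s [s0 sE]] := @chain_homotopy C T (fun i => u i \- v i) Cc Cp Te.
- by move=> i x; rewrite /= linearB uc vc.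
- by move=> x; rewrite /= uv0 subrr.
have sn0 : n = 0%N -> forall x, s n x = 0 by move=> ->.
exists (z \o s n); split=> [n0 x|x /=]; first by rewrite /= sn0 ?linear0.
by rewrite -linearB; move: (sE n x) => /= ->; rewrite linearD zc add0r.
Qed.

(** The free resolution that defines Ext, with its augmentation to [N]. *)
Definition resC_mod N (i : nat) : lmodType R :=
  if i is j.+1 then res N j else N.

Definition resC_d N i : {linear resC_mod N i.+1 -> resC_mod N i} :=
  if i is j.+1 return {linear resC_mod N i.+1 -> resC_mod N i}
  then res_d N j else cover_map N.

Definition resC N : acomplex := AComplex (resC_d N).

Lemma cover_mapE N (x : N) : cover_map N << x >> = x.
Proof. exact: free_liftE. Qed.

Lemma cover_map_res_d N i (x : res N i.+1) :
  cover_map (syz N i) (res_d N i x) = 0.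
Proof. by have /asboolP := valP (cover_map (syz N i.+1) x). Qed.

Lemma resC_complex N : is_complex (resC N).
Proof.
case=> [//|[|i]] x; first exact: (cover_map_res_d (i := 0)).
exact: (congr1 val (cover_map_res_d x)).
Qed.

Lemma resC_exact N : exact_complex (resC N).
Proof.
have H i (x : res N i) : cover_map (syz N i) x = 0 -> exists y, res_d N i y = x.
  move=> x0; have xK : x \in ker_submod (cover_map (syz N i)) by apply/asboolP.
  exists (<< (Sub x xK : syz N i.+1) >>).
  exact: (congr1 val (cover_mapE (Sub x xK : syz N i.+1))).
case=> [|[|i]] x xc; first by exists (<< x >>); apply: cover_mapE.
  exact: (H 0%N).
by apply: H; apply: val_inj; rewrite [LHS]xc.
Qed.

Lemma resC_projective N : projective_complex (resC N).
Proof. by move=> i; apply: projective_free. Qed.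

Definition resC_map N N' (f : {linear N -> N'}) i :
    {linear resC N i -> resC N' i} :=
  if i is j.+1 return {linear resC N i -> resC N' i} then res_map f j else f.

Lemma resC_map_chain N N' (f : {linear N -> N'}) : chain_map (resC_map f).
Proof.
case=> [|i] x; first exact: cover_map_natural.
exact/esym/res_map_d.
Qed.

End Complexes.

(** * The mapping cone as a resolution of the cokernel *)

Section Cone.
Variable R : comNzRingType.

Definition ses (A B C : lmodType R) (f : {linear A -> B}) (g : {linear B -> C}) :=
  [/\ forall x, f x = 0 -> x = 0, forall x, g (f x) = 0,
      forall y, g y = 0 -> exists x, f x = y & forall z, exists y, g y = z].

Lemma ses_ker (A B : lmodType R) (g : {linear A -> B}) : (forall z, exists y, g y = z) ->
  ses (val : {linear submod_of (ker_submod g) -> A}) g.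
Proof.
move=> gsurj; split=> // [x x0|x|y gy]; first exact: val_inj.
  by apply/eqP; rewrite -in_ker; apply: valP.
by have yK : y \in ker_submod g; [rewrite in_ker gy | exists (Sub y yK)].
Qed.

Lemma ses_quot (A B : lmodType R) (f : {linear A -> B}) (S : submodClosed B) :
  (forall x, f x = 0 -> x = 0) -> (forall y, y \in S <-> exists x, f x = y) ->
  ses f (quot_proj S : {linear B -> quot_mod S}).
Proof.
move=> f_inj fS; split=> // [x|y|q].
- by apply/quot_proj_eq0/fS; exists x.
- by move=> /quot_proj_eq0/fS.
- by exists (repr q); exact: quot_projK.
Qed.

Variables (P Q : acomplex R) (F : forall i, {linear P i -> Q i}).
Variables (C : lmodType R) (g : {linear Q 0%N -> C}).

(** The cone of [F] with its degree-0 part A -> B replaced by the cokernel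
    C of that part, so that it is augmented to [C]; the shift by one is why the
    summand of [P] starts in degree 2. *)
Definition cone_mod (i : nat) : lmodType R :=
  match i with
  | 0%N => C
  | 1%N => Q 1%N
  | j.+2 => (Q j.+2 * P j.+1)%type
  end.

Fact cone_d_linear i : linear (fun y : Q i.+3 * P i.+2 =>
  (acd Q i.+2 y.1 + F i.+2 y.2, - acd P i.+1 y.2) : (Q i.+2 * P i.+1)%type).
Proof.
move=> c x y; congr pair; rewrite /=.
  by rewrite !linearP /= scalerDr addrACA.
by rewrite linearP opprD scalerN.
Qed.

Definition cone_d i : {linear cone_mod i.+1 -> cone_mod i} :=
  match i return {linear cone_mod i.+1 -> cone_mod i} with
  | 0%N => g \o acd Q 0%N
  | 1%N => (acd Q 1%N \o fst) \+ (F 1%N \o snd)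
  | j.+2 => mk_linear (@cone_d_linear j)
  end.

Definition cone : acomplex R := AComplex cone_d.

Fact cone_in_linear j : linear (fun q : Q j.+2 => (q, 0) : (Q j.+2 * P j.+1)%type).
Proof. by move=> c x y; congr pair; rewrite /= scaler0 addr0. Qed.

Definition cone_in i : {linear Q i -> cone i} :=
  match i return {linear Q i -> cone i} with
  | 0%N => g
  | 1%N => idfun
  | j.+2 => mk_linear (@cone_in_linear j)
  end.

Definition cone_snd i : {linear cone i.+2 -> P i.+1} :=
  (snd : {linear (Q i.+2 * P i.+1)%type -> P i.+1}).

Definition cone_fst i : {linear cone i.+1 -> Q i.+1} :=
  match i return {linear cone i.+1 -> Q i.+1} with
  | 0%N => idfun
  | j.+1 => (fst : {linear (Q j.+2 * P j.+1)%type -> Q j.+2})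
  end.

Fact cone_inr_linear j : linear (fun p : P j.+1 => (0, p) : (Q j.+2 * P j.+1)%type).
Proof. by move=> c x y; congr pair; rewrite /= scaler0 addr0. Qed.

Definition cone_inr i : {linear P i.+1 -> cone i.+2} :=
  mk_linear (@cone_inr_linear i).

Lemma cone_split i (k : cone i.+2) :
  k = cone_in i.+2 (cone_fst i.+1 k) + cone_inr i (cone_snd i k).
Proof. by case: k => q p; congr pair; rewrite /= ?addr0 ?add0r. Qed.

Lemma cone_fst_d i (k : cone i.+2) : cone_fst i (acd cone i.+1 k) =
  acd Q i.+1 (cone_fst i.+1 k) + F i.+1 (cone_snd i k).
Proof. by case: i k. Qed.

Hypotheses (Pc : is_complex P) (Qc : is_complex Q).
Hypotheses (Pe : exact_complex P) (Qe : exact_complex Q) (Fc : chain_map F).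
Hypothesis (Fg : ses (F 0%N) g).

Lemma cone_in_chain : chain_map cone_in.
Proof.
case=> [//|[|i]] x; first by rewrite /= linear0 addr0.
by congr pair; rewrite /= linear0 ?addr0 ?oppr0.
Qed.

Lemma cone_sndE i y : cone_snd i (acd cone i.+2 y) = - acd P i.+1 (cone_snd i.+1 y).
Proof. by []. Qed.

Lemma cone_complex : is_complex cone.
Proof.
have [Finj gF _ _] := Fg.
case=> [//|[|[|i]]] x /=.
- by rewrite linearD (Qc (i := 1)) add0r Fc gF.
- by rewrite !linearD linearN (Qc (i := 2)) add0r Fc subrr.
- congr pair; rewrite /= ?linearD linearN.
    by rewrite (Qc (i := i.+3)) add0r Fc subrr.
  by rewrite (Pc (i := i.+2)) oppr0 ?oppr0.
Qed.

(** In low degrees, exactness of 0 -> A -> B -> C -> 0 replaces that of [P]: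
    surjectivity of [g] in degree 0, exactness at B in degree 1 and injectivity
    of A -> B in degree 2. *)
Lemma cone_exact : exact_complex cone.
Proof.
have [Finj gF gE gsurj] := Fg.
have step j (q : Q j.+2) (p : P j.+1) : acd P j p = 0 ->
    acd Q j.+1 q + F j.+1 p = 0 ->
    exists y, acd cone j.+2 y = ((q, p) : (Q j.+2 * P j.+1)%type).
  move=> dp dq; have [p' p'E] := Pe (dp : is_cycle (C := P) (i := j.+1) p).
  have [|q' q'E] := Qe (x := q + F j.+2 p').
    by rewrite /= linearD Fc p'E.
  exists ((q', - p') : (Q j.+3 * P j.+2)%type).
  by congr pair; rewrite /= linearN ?p'E ?opprK// q'E addrK.
case=> [|[|[|i]]].
- move=> c _ /=; have [b gb] := gsurj c.
  by have [q dq] := Qe (i := 0) (x := b) I; exists q; rewrite /= dq.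
- move=> q /= gq; have [a Fa] := gE _ gq.
  have [p dp] := Pe (i := 0) (x := a) I.
  have [|q' dq'] := Qe (i := 1) (x := q - F 1%N p).
    by rewrite /= linearB Fc dp Fa subrr.
  by exists ((q', p) : (Q 2 * P 1)%type); rewrite /= dq' subrK.
- move=> [q p] /= qp; apply: step => //; apply: Finj.
  have := congr1 (acd Q 0%N) qp.
  by rewrite linearD (Qc (i := 1)) add0r Fc linear0.
- move=> [q p] /= []qp /eqP; rewrite oppr_eq0 => /eqP dp.
  exact: step.
Qed.

Lemma cone_projective :
  projective_complex P -> projective_complex Q -> projective_complex cone.
Proof. by move=> Pp Qp [|i]; [exact: Qp | exact: projective_pair]. Qed.

End Cone.

(** * Ext classes and functoriality *)

Section ExtClasses.
Variables (R : comNzRingType) (X : lmodType R).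
Implicit Types N A B C : lmodType R.

Lemma cocyclesP N n (z : {linear res N n -> X}) :
  reflect (cocycle (C := resC N) (n := n) z) (z \in cocycles X N n).
Proof.
apply: (iffP (asboolP _)) => [z0 x|zc].
  exact: (congr1 (fun h : Hom_mod _ _ => h x) z0).
by apply: linear_ext => x; apply: zc.
Qed.

Lemma coboundariesP N n (z : {linear res N n -> X}) :
  reflect (coboundary (C := resC N) (n := n) z) (z \in coboundaries X N n).
Proof.
apply: (iffP (asboolP _)); case: n z => [|n] z /=.
- by move=> ->; exists \0.
- by move=> [y _ <-]; exists y.
- move=> [y [y0 zy]]; apply: linear_ext => x.
  by rewrite [LHS]zy y0.
- by move=> [y [_ zy]]; exists y => //; apply: linear_ext => x; rewrite [RHS]zy.
Qed.

Definition Ext_class N n (z : {linear res N n -> X}) (zc : z \in cocycles X N n) :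
  Ext X n N := quot_proj _ (Sub z zc).

Lemma Ext_class_surj N n (e : Ext X n N) : exists z (zc : z \in cocycles X N n), e = Ext_class zc.
Proof. by rewrite -(quot_projK e); case: (repr e) => z zc; exists z, zc. Qed.

Lemma Ext_class_eq N n (z z' : {linear res N n -> X}) (zc : z \in cocycles X N n)
    (zc' : z' \in cocycles X N n) :
  Ext_class zc = Ext_class zc' <-> coboundary (C := resC N) (n := n) (z \- z').
Proof.
split=> [/eqP|H].
  by rewrite quot_projP => /asboolP /coboundariesP.
by apply/eqP; rewrite quot_projP; apply/asboolP/coboundariesP.
Qed.

Lemma Ext_class_eq0 N n (z : {linear res N n -> X}) (zc : z \in cocycles X N n) :
  Ext_class zc = 0 <-> coboundary (C := resC N) (n := n) z.
Proof.
split=> [/quot_proj_eq0 /asboolP /coboundariesP //|H].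
by apply/quot_proj_eq0/asboolP/coboundariesP.
Qed.

Lemma Ext_class_linear N n c (z y x : {linear res N n -> X}) (zc : z \in cocycles X N n)
    (yc : y \in cocycles X N n) (xc : x \in cocycles X N n) :
  (forall t, z t = c *: y t + x t) -> Ext_class zc = c *: Ext_class yc + Ext_class xc.
Proof.
move=> zyx; rewrite /Ext_class -linearP; congr (quot_proj _ _); apply: val_inj.
exact: linear_ext.
Qed.

Lemma cocycle_comp (C T : acomplex R) (u : forall i, {linear C i -> T i}) n
    (z : {linear T n.+1 -> X}) :
  chain_map u -> cocycle z -> cocycle (z \o u n.+1).
Proof. by move=> uc zc x; rewrite /= -uc zc. Qed.

(** [Ext_map] uses the standard lift of [f] to the resolutions; being free to use
    any other lift yields functoriality and additivity at once. *)
Lemma Ext_map_chain N N' (f : {linear N -> N'}) n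
    (u : forall i, {linear resC N i -> resC N' i}) (z : {linear res N' n -> X})
    (zc : z \in cocycles X N' n) :
  chain_map u -> u 0%N =1 f ->
  exists zc' : precomp X (u n.+1 : {linear res N n -> res N' n}) z \in cocycles X N n,
    Ext_map X f n (Ext_class zc) = Ext_class zc'.
Proof.
move=> uc uf.
have zc' : precomp X (u n.+1 : {linear res N n -> res N' n}) z \in cocycles X N n.
  by apply/cocyclesP; apply: cocycle_comp uc _; apply/cocyclesP.
exists zc'; rewrite /Ext_map /subquot_map [LHS]quot_mapE.
apply/Ext_class_eq; apply: (chain_map_unique (u := resC_map f) (v := u)) => //.
- exact: resC_complex.
- exact: resC_projective.
- exact: resC_exact.
- exact: resC_map_chain.
- exact/cocyclesP.
Qed.

Lemma Ext_map_id N (f : {linear N -> N}) n e : f =1 id -> Ext_map X f n e = e.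
Proof.
move=> f1; have [z [zc ->]] := Ext_class_surj e.
have [||zc' ->] := Ext_map_chain (f := f) (u := fun i => idfun) zc => //.
by congr (quot_proj _ _); apply: val_inj; apply: linear_ext.
Qed.

Lemma Ext_map_comp N N' N'' (f : {linear N -> N'}) (g : {linear N' -> N''})
    (h : {linear N -> N''}) n e : (forall x, h x = g (f x)) ->
  Ext_map X h n e = Ext_map X f n (Ext_map X g n e).
Proof.
move=> hE; have [z [zc ->]] := Ext_class_surj e.
have [|//|zc1 ->] := Ext_map_chain (f := g) (u := resC_map g) zc.
  exact: resC_map_chain.
have [|//|zc2 ->] := Ext_map_chain (f := f) (u := resC_map f) zc1.
  exact: resC_map_chain.
have [||zc3 ->] := Ext_map_chain (f := h) (u := fun i => resC_map g i \o resC_map f i) zc.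
- by apply: chain_map_comp; exact: resC_map_chain.
- by move=> x; rewrite hE.
by congr (quot_proj _ _); apply: val_inj; apply: linear_ext.
Qed.

Lemma Ext_map_linear N N' c (f g h : {linear N -> N'}) n e :
  (forall x, f x = c *: g x + h x) ->
  Ext_map X f n e = c *: Ext_map X g n e + Ext_map X h n e.
Proof.
move=> fE; have [z [zc ->]] := Ext_class_surj e.
have [||zc1 ->] :=
    Ext_map_chain (f := f) (u := fun i => (c \*: resC_map g i) \+ resC_map h i) zc.
- move=> i x; rewrite /= linearD linearZ.
  by rewrite (resC_map_chain g) (resC_map_chain h).
- by move=> x; rewrite fE.
have [|//|zc2 ->] := Ext_map_chain (f := g) (u := resC_map g) zc.
  exact: resC_map_chain.
have [|//|zc3 ->] := Ext_map_chain (f := h) (u := resC_map h) zc.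
  exact: resC_map_chain.
by apply: Ext_class_linear => t; rewrite /= linearD linearZ.
Qed.

Lemma Ext_map0 N N' (f : {linear N -> N'}) n e :
  (forall x, f x = 0) -> Ext_map X f n e = 0.
Proof.
move=> f0; apply: (@addrI _ (Ext_map X f n e)).
rewrite addr0 -{1}[Ext_map X f n e]scale1r; apply/esym/Ext_map_linear => x.
by rewrite !f0 scaler0 addr0.
Qed.

End ExtClasses.

(** * The long exact sequence of Ext in the first variable *)

Lemma subr_shift (V : zmodType) (p q r s t : V) :
  q = s + t -> p - q = r -> p - t = r + s.
Proof. by move=> -> <-; rewrite opprD addrA addrAC subrK. Qed.

Section LongExact.
Variables (R : comNzRingType) (X : lmodType R).

Section OneSequence.
Variables (A B C : lmodType R) (f : {linear A -> B}) (g : {linear B -> C}).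
Hypothesis fg : ses f g.

Let K := cone (resC_map f) g.

Let K_complex : is_complex K.
Proof.
apply: cone_complex; first [exact: resC_complex | exact: resC_map_chain | exact: fg].
Qed.

Let K_exact : exact_complex K.
Proof.
apply: cone_exact; first [exact: resC_complex | exact: resC_exact |
  exact: resC_map_chain | exact: fg].
Qed.

Let K_projective : projective_complex K.
Proof. by apply: cone_projective; exact: resC_projective. Qed.

(** Such a [w] realizes the comparison of the resolution of C with the cone; its
    component in P is the connecting homomorphism. *)
Definition cone_lift (w : forall i, {linear resC C i -> K i}) : Prop :=
  chain_map w /\ w 0%N =1 id.

Lemma cone_lift_exists : exists w, cone_lift w.
Proof.
have [w [w0 wc]] := chain_lift (C := resC C) (T := K) idfun
  (@resC_complex _ C) (@resC_projective _ C) K_exact.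
by exists w; split=> //; rewrite w0.
Qed.

(** Left exactness of Hom, seen on cocycles. *)
Lemma Ext_inj0 (e : Ext X 0 C) : Ext_map X g 0 e = 0 -> e = 0.
Proof.
have [_ _ _ gsurj] := fg.
have [z [zc ->]] := Ext_class_surj e.
have [|//|zc1 ->] := Ext_map_chain (f := g) (u := resC_map g) zc.
  exact: resC_map_chain.
move=> /Ext_class_eq0 [y [/(_ erefl) y0 zy]]; apply/Ext_class_eq0; exists \0.
split=> // x; have [b gb] := gsurj (cover_map C x).
have [q qb] := resC_exact (N := B) (i := 0%N) (x := b) I.
have [|x' x'E] := resC_exact (N := C) (i := 1%N) (x := x - resC_map g 1 q).
  by rewrite /= -[LHS]/(acd (resC C) 0%N _) linearB (resC_map_chain g) qb gb subrr.
move: zc => /cocyclesP /(_ x'); rewrite x'E linearB => /eqP; rewrite subr_eq0.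
by move=> /eqP->; rewrite [LHS]zy y0.
Qed.

(** If the pullback of z to A bounds y, then z and y form a cocycle on the cone;
    its pullback along the comparison map [w] is a class on C, and it restricts
    to z because [w] after the map of resolutions B -> C and the inclusion of
    the resolution of B in the cone both cover [g]. *)
Lemma Ext_exact n (e : Ext X n B) :
  Ext_map X f n e = 0 -> exists e', Ext_map X g n e' = e.
Proof.
have [w wl] := cone_lift_exists; have [z [zc ->]] := Ext_class_surj e.
have [|//|zc1 ->] := Ext_map_chain (f := f) (u := resC_map f) zc.
  exact: resC_map_chain.
move=> /Ext_class_eq0 [y [y0 zy]].
have [k [kc kE]] : exists k : {linear K n.+1 -> X}, cocycle k /\
    forall q, k (cone_in (resC_map f) g n.+1 q) = z q.
  move/cocyclesP: zc => zc; case: n z y {zc1 e} y0 zy zc => [|n] z y y0 zy zc.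
    exists z; split=> // x; rewrite [LHS]/= linearD -[X in X + _]/(z (acd (resC B) 1 _)).
    by rewrite zc add0r; have /= -> := zy x.2; rewrite y0.
  exists ((z \o fst) \+ (y \o snd)); split=> [x|q]; last by rewrite /= linear0 addr0.
  rewrite [LHS]/= !linearD linearN.
  have -> : z (res_d B n.+1 x.1) = 0 by exact: zc.
  by rewrite add0r; have /= -> := zy x.2; rewrite subrr.
have zc' : precomp X (w n.+1 : {linear res C n -> K n.+1}) k \in cocycles X C n.
  by apply/cocyclesP; exact: cocycle_comp wl.1 kc.
exists (Ext_class zc').
have [|//|zc2 ->] := Ext_map_chain (f := g) (u := resC_map g) zc'.
  exact: resC_map_chain.
apply/Ext_class_eq.
have [|||||||y' [y0' y'E]] := chain_map_unique (C := resC B) (T := K) (n := n)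
  (u := fun i => w i \o resC_map g i) (v := cone_in (resC_map f) g) (z := k).
- exact: resC_complex.
- exact: resC_projective.
- exact: K_exact.
- by apply: chain_map_comp wl.1; apply: resC_map_chain.
- exact: cone_in_chain.
- by move=> x; rewrite /= wl.2.
- exact: kc.
by exists y'; split=> // x; rewrite -y'E /= kE.
Qed.

Definition Ext_conn_map n (w : forall i, {linear resC C i -> K i}) :
    {linear res C n.+1 -> res A n} :=
  (cone_snd (resC_map f) g n : {linear K n.+2 -> res A n}) \o w n.+2.

(** The sign comes from the differential of the cone; it is harmless because only
    kernels and images of the connecting map matter. *)
Lemma Ext_conn_map_d n w : cone_lift w ->
  forall x, Ext_conn_map n w (res_d C n.+1 x) = - (res_d A n (Ext_conn_map n.+1 w x)).
Proof.
move=> [wc _] x.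
rewrite -[LHS]/(cone_snd (resC_map f) g n (w n.+2 (acd (resC C) n.+2 x))).
by rewrite -wc cone_sndE.
Qed.

Variable w : forall i, {linear resC C i -> K i}.
Hypothesis wl : cone_lift w.

Fact Ext_conn_cocycles n z :
  z \in cocycles X A n -> precomp X (Ext_conn_map n w) z \in cocycles X C n.+1.
Proof.
move=> /cocyclesP zc; apply/cocyclesP => x.
change (z (Ext_conn_map n w (res_d C n.+1 x)) = 0).
by rewrite Ext_conn_map_d// linearN [z _]zc oppr0.
Qed.

Fact Ext_conn_coboundaries n z :
  z \in coboundaries X A n -> precomp X (Ext_conn_map n w) z \in coboundaries X C n.+1.
Proof.
move=> /asboolP; case: n z => [|n] z /=.
  move=> ->; apply/asboolP; exists 0 => //.
  by rewrite !linear0.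
move=> [y _ <-]; apply/asboolP; exists (- precomp X (Ext_conn_map n w) y) => //.
apply: linear_ext => x.
change (- y (Ext_conn_map n w (res_d C n.+1 x)) = y (res_d A n (Ext_conn_map n.+1 w x))).
by rewrite Ext_conn_map_d// linearN opprK.
Qed.

Definition Ext_conn n : {linear Ext X n A -> Ext X n.+1 C} :=
  subquot_map (@Ext_conn_cocycles n) (@Ext_conn_coboundaries n).

Lemma Ext_connE n z (zc : z \in cocycles X A n) :
  Ext_conn n (Ext_class zc) = Ext_class (Ext_conn_cocycles zc).
Proof. by rewrite [LHS]quot_mapE; congr (quot_proj _ _); apply: val_inj. Qed.

(** Pull the cocycle z on C back to the cone by a comparison map [v].  Its
    component on the resolution of B is homologous to the pullback of z to B,
    hence a coboundary; subtracting that coboundary leaves a cocycle [al]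
    supported on the resolution of A.  Since v o w is homotopic to the identity,
    the class of z is the image of that of [al]. *)
Lemma Ext_conn_exact n (e : Ext X n.+1 C) :
  Ext_map X g n.+1 e = 0 -> exists e', Ext_conn n e' = e.
Proof.
have [z [zc ->]] := Ext_class_surj e.
have [|//|zc1 ->] := Ext_map_chain (f := g) (u := resC_map g) zc.
  exact: resC_map_chain.
move=> /Ext_class_eq0 [b [_ zb]]; have zcc := elimT (cocyclesP _) zc.
have [v [v0 vc]] := chain_lift (C := K) (T := resC C) idfun
  K_complex K_projective (@resC_exact _ C).
have [|||||||y [_ yE]] := chain_map_unique (C := resC B) (T := resC C) (n := n.+1)
  (u := fun i => v i \o cone_in (resC_map f) g i) (v := resC_map g) (z := z).
- exact: resC_complex.
- exact: resC_projective.
- exact: resC_exact.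
- by apply: chain_map_comp vc; apply: cone_in_chain.
- exact: resC_map_chain.
- by move=> x; rewrite /= v0.
- exact: zcc.
have [b' vb'] : exists b' : {linear resC B n.+1 -> X}, forall q,
    z (v n.+2 (cone_in (resC_map f) g n.+2 q)) = b' (acd (resC B) n.+1 q).
  exists (y \+ b) => q; rewrite [RHS]/= -(yE q) -(zb q); exact: esym (subrK _ _).
pose al : {linear res A n -> X} := (z \o (v n.+2 \o cone_inr (resC_map f) g n))
  \- (b' \o resC_map f n.+1).
have zv k : z (v n.+2 k) = b' (cone_fst (resC_map f) g n (acd K n.+1 k))
    + al (cone_snd (resC_map f) g n k).
  rewrite {1}(cone_split k) !linearD vb' cone_fst_d linearD -!addrA.
  by congr (_ + _); rewrite [RHS]addrC; exact: esym (subrK _ _).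
have alc : al \in cocycles X A n.
  apply/cocyclesP => p; pose k := cone_inr (resC_map f) g n.+1 (- p).
  have := zv (acd K n.+2 k); rewrite -vc zcc [acd K _ (acd K _ _)](K_complex (i := n.+2)).
  rewrite !linear0 add0r cone_sndE => /esym.
  by rewrite -[cone_snd _ _ _ k]/(- p) [acd (resC A) _ (- p)]linearN opprK.
exists (Ext_class alc); rewrite Ext_connE; apply/esym/Ext_class_eq.
have [|||||||y' [_ y'E]] := chain_map_unique (C := resC C) (T := resC C) (n := n.+1)
  (u := fun i => idfun) (v := fun i => v i \o w i) (z := z).
- exact: resC_complex.
- exact: resC_projective.
- exact: resC_exact.
- by [].
- exact: chain_map_comp wl.1 vc.
- by move=> x; rewrite /= wl.2 v0.
- exact: zcc.
exists (y' \+ (b' \o (cone_fst (resC_map f) g n \o w n.+1))); split=> // x.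
have wx : acd K n.+1 (w n.+2 x) = w n.+1 (acd (resC C) n.+1 x) by exact: wl.1.
have := zv (w n.+2 x); rewrite wx => E.
exact: (subr_shift E (y'E x)).
Qed.

End OneSequence.

Section Squares.
Variables (A B A' B' : lmodType R).
Variables (f : {linear A -> B}) (f' : {linear A' -> B'}).
Variables (a : {linear A -> A'}) (b : {linear B -> B'}).

Lemma cover_fmap_square : (forall x, b (f x) = f' (a x)) ->
  forall x, cover_fmap b (cover_fmap f x) = cover_fmap f' (cover_fmap a x).
Proof.
move=> baE; apply: (freeg_linear_ext (f := cover_fmap b \o cover_fmap f)
  (g := cover_fmap f' \o cover_fmap a)) => x.
change (cover_fmap b (cover_fmap f << x >>) = cover_fmap f' (cover_fmap a << x >>)).
rewrite [cover_fmap f _]free_liftE [cover_fmap a _]free_liftE.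
by rewrite [LHS]free_liftE [RHS]free_liftE baE.
Qed.

End Squares.

Lemma resC_map_square (A B A' B' : lmodType R) (f : {linear A -> B})
    (f' : {linear A' -> B'}) (a : {linear A -> A'}) (b : {linear B -> B'}) :
  (forall x, b (f x) = f' (a x)) -> forall i x,
  resC_map b i (resC_map f i x) = resC_map f' i (resC_map a i x).
Proof.
move=> baE; case=> [//|i] x.
apply: cover_fmap_square => {x}; elim: i => [//|i IH] x.
by apply: val_inj; apply: cover_fmap_square.
Qed.

Section Naturality.
Variables (A B C A' B' C' : lmodType R).
Variables (f : {linear A -> B}) (g : {linear B -> C}).
Variables (f' : {linear A' -> B'}) (g' : {linear B' -> C'}).
Hypotheses (fg : ses f g) (fg' : ses f' g').
Variables (a : {linear A -> A'}) (b : {linear B -> B'}) (c : {linear C -> C'}).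
Hypotheses (baE : forall x, b (f x) = f' (a x)) (cbE : forall x, c (g x) = g' (b x)).

Let K := cone (resC_map f) g.
Let K' := cone (resC_map f') g'.

Fact cone_map_linear j :
  linear (fun k : (resC B j.+2 * resC A j.+1)%type =>
    (resC_map b j.+2 k.1, resC_map a j.+1 k.2) : (resC B' j.+2 * resC A' j.+1)%type).
Proof. by move=> r x y; congr pair; exact: linearP. Qed.

Definition cone_map i : {linear K i -> K' i} :=
  match i return {linear K i -> K' i} with
  | 0%N => c
  | 1%N => resC_map b 1
  | j.+2 => mk_linear (@cone_map_linear j)
  end.

Lemma cone_map_chain : chain_map cone_map.
Proof.
have bc := resC_map_chain b; have ac := resC_map_chain a.
have sq := resC_map_square baE.
case=> [|[|i]] x.
- change (g' (acd (resC B') 0 (resC_map b 1 x)) = c (g (acd (resC B) 0 x))).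
  by rewrite bc cbE.
- case: x => q p; change (acd (resC B') 1 (resC_map b 2 q)
    + resC_map f' 1 (resC_map a 1 p)
    = resC_map b 1 (acd (resC B) 1 q + resC_map f 1 p)).
  by rewrite linearD bc sq.
- case: x => q p; congr pair.
    change (acd (resC B') i.+2 (resC_map b i.+3 q)
    + resC_map f' i.+2 (resC_map a i.+2 p)
    = resC_map b i.+2 (acd (resC B) i.+2 q + resC_map f i.+2 p)).
    by rewrite linearD bc sq.
  change (- acd (resC A') i.+1 (resC_map a i.+2 p) =
    resC_map a i.+1 (- acd (resC A) i.+1 p)).
  by rewrite linearN ac.
Qed.

(** The comparison maps are not natural on the nose, but both ways around the
    square are chain maps from the resolution of C to the cone of the second
    sequence that cover [c]. *)
Lemma Ext_conn_natural (w : forall i, {linear resC C i -> K i}) (wl : cone_lift w)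
    (w' : forall i, {linear resC C' i -> K' i}) (wl' : cone_lift w') n e :
  Ext_conn wl n (Ext_map X a n e) = Ext_map X c n.+1 (Ext_conn wl' n e).
Proof.
have [z [zc ->]] := Ext_class_surj e.
have [|//|zc1 ->] := Ext_map_chain (f := a) (u := resC_map a) zc.
  exact: resC_map_chain.
rewrite !Ext_connE.
have [|//|zc2 ->] := Ext_map_chain (f := c) (u := resC_map c) (Ext_conn_cocycles wl' zc).
  exact: resC_map_chain.
apply/Ext_class_eq.
pose k : {linear K' n.+2 -> X} :=
  (z : {linear res A' n -> X}) \o (cone_snd (resC_map f') g' n).
apply: (chain_map_unique (C := resC C) (T := K') (n := n.+1)
  (u := fun i => cone_map i \o w i) (v := fun i => w' i \o resC_map c i) (z := k)).
- exact: resC_complex.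
- exact: resC_projective.
- apply: cone_exact; first [exact: resC_complex | exact: resC_exact |
  exact: resC_map_chain | exact: fg'].
- exact: chain_map_comp wl.1 cone_map_chain.
- exact: chain_map_comp (resC_map_chain c) wl'.1.
- by move=> x; rewrite /= wl.2 wl'.2.
- move=> x; move/cocyclesP: zc => zc.
  change (z (- acd (resC A') n.+1 (cone_snd (resC_map f') g' n.+1 x)) = 0).
  by rewrite linearN [z _]zc oppr0.
Qed.

End Naturality.
End LongExact.

(** * Direct limits of sequences *)

Section DirectLimit.
Variables (R : comNzRingType) (E : nat -> lmodType R).
Variable f : forall k, {linear E k -> E k.+1}.

Lemma dinj_in k (x : E k) : dinj x k = x.
Proof. exact: dfwith_in. Qed.

Lemma dinj_out k (x : E k) j : k != j -> dinj x j = 0.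
Proof. exact: dfwith_out. Qed.

Lemma dinj_linear k : linear (@dinj R E k).
Proof.
move=> c x y; apply: dprod_ext => j.
change (dinj (c *: x + y) j = c *: dinj x j + dinj y j).
have [jk|jk] := eqVneq k j; first by case: _ / jk; rewrite !dinj_in.
by rewrite !dinj_out// scaler0 addr0.
Qed.

Lemma dinj_dsum k (x : E k) : dinj x \in dsum E.
Proof.
apply/asboolP; exists k.+1 => j kj; rewrite dinj_out//.
by rewrite neq_ltn kj.
Qed.

Fact dlim_class_linear k :
  linear (fun x : E k => quot_proj (subquot_submod (dsum E) (dlim_rel f))
    (Sub (dinj x) (dinj_dsum x)) : dlim f).
Proof.
move=> c x y; rewrite -linearP; congr (quot_proj _ _).
by apply: val_inj; rewrite /= dinj_linear.
Qed.

Definition dlim_class k : {linear E k -> dlim f} := mk_linear (@dlim_class_linear k).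

Lemma dlim_class_step k (x : E k) : dlim_class k.+1 (f k x) = dlim_class k x.
Proof.
apply/esym/eqP; rewrite quot_projP; apply/asboolP.
by apply: mem_gen; exists k, x.
Qed.

(** A finitely supported family is pushed step by step to the last degree of its
    support. *)
Lemma dlim_class_surj (q : dlim f) : exists k x, q = dlim_class k x.
Proof.
rewrite -(quot_projK q); case: (repr q) => z zS.
have key m : forall z : dprod E, (forall k, (m < k)%N -> z k = 0) ->
    exists x : E m, z - dinj x \in dlim_rel f.
  elim: m => [|m IH] {zS}z z0.
    exists (z 0%N); suff -> : z - dinj (z 0%N) = 0 by rewrite rpred0.
    apply: dprod_ext => j; change (z j - dinj (z 0%N) j = 0).
    case: j => [|j]; first by rewrite dinj_in subrr.
    by rewrite dinj_out// z0// subr0.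
  have [k mk|x zx] := IH (z - dinj (z m.+1)).
    change (z k - dinj (z m.+1) k = 0).
    move: mk; rewrite leq_eqVlt => /orP[/eqP<-|mk].
      by rewrite dinj_in subrr.
    by rewrite z0// dinj_out ?subr0// neq_ltn mk.
  exists (f m x + z m.+1).
  have := dinj_linear 1 (f m x) (z m.+1); rewrite !scale1r => ->.
  have -> : z - (dinj (f m x) + dinj (z m.+1)) =
      (z - dinj (z m.+1) - dinj x) + (dinj x - dinj (f m x)).
    by rewrite addrA subrK opprD addrA addrAC.
  by apply: rpredD => //; apply: mem_gen; exists m, x.
have /asboolP[m zm] := zS; have [k mk|x zx] := key m z; first exact/zm/ltnW.
by exists m, x; apply/eqP; rewrite quot_projP; apply/asboolP.
Qed.

Fixpoint dlim_trans k d : {linear E k -> E (d + k)%N} :=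
  if d is d'.+1 return {linear E k -> E (d + k)%N}
  then f (d' + k)%N \o dlim_trans k d' else idfun.

Lemma compat_trans (W : lmodType R) (g : forall k, {linear E k -> W}) :
  (forall k x, g k.+1 (f k x) = g k x) ->
  forall k d x, g (d + k)%N (dlim_trans k d x) = g k x.
Proof. by move=> gf k d x; elim: d => [//|d IH] /=; rewrite gf. Qed.

(** The image in degree m of the part of [z] below m.  A relation x - f x has zero
    image from some degree on, so this detects which classes vanish in the
    limit. *)
Fixpoint dpartial (z : dprod E) m : E m :=
  if m is k.+1 return E m then f k (dpartial z k + z k) else 0.

Lemma dpartial_linear c (u v : dprod E) m :
  dpartial (c *: u + v) m = c *: dpartial u m + dpartial v m.
Proof.
elim: m => [|m IH] /=; first by rewrite scaler0 addr0.
rewrite IH -linearP; congr (f m _).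
change (c *: dpartial u m + dpartial v m + (c *: u m + v m) =
   c *: (dpartial u m + u m) + (dpartial v m + v m)).
by rewrite scalerDr addrACA.
Qed.

Lemma dpartial_stable (z : dprod E) m k : (forall j, (m <= j)%N -> z j = 0) ->
  dpartial z m = 0 -> (m <= k)%N -> dpartial z k = 0.
Proof.
move=> z0 zm /subnK <-; elim: (k - m)%N => [//|d IH] /=.
by rewrite IH z0 ?addr0 ?linear0// leq_addl.
Qed.

Lemma dpartial_dinj_le k (x : E k) m : (m <= k)%N -> dpartial (dinj x) m = 0.
Proof.
elim: m => [//|m IH] mk /=; rewrite IH ?(ltnW mk)// add0r.
by rewrite dinj_out ?linear0// neq_ltn mk orbT.
Qed.

Lemma dpartial_dinj k d (x : E k) :
  dpartial (dinj x) (d.+1 + k)%N = dlim_trans k d.+1 x.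
Proof.
elim: d => [|d IH].
  by rewrite /= dpartial_dinj_le// add0r dinj_in.
rewrite [LHS]/= -[f _ (dpartial _ _ + _)]/(dpartial (dinj x) (d.+1 + k)%N) IH.
by rewrite dinj_out ?addr0// neq_ltn ltnS leq_addl.
Qed.

Lemma dlim_class_eq0 k (x : E k) : dlim_class k x = 0 -> exists d, dlim_trans k d x = 0.
Proof.
move=> /quot_proj_eq0 /asboolP; rewrite /mkset /= => xrel.
have H : is_submod [set z : dprod E | exists m, dpartial z m = 0 /\
    forall k, (m <= k)%N -> z k = 0].
  split=> [|c u v [m [um u0]] [m' [vm v0]]]; first by exists 0%N.
  exists (maxn m m'); rewrite dpartial_linear.
  rewrite (dpartial_stable _ um) ?leq_maxl// (dpartial_stable _ vm) ?leq_maxr//.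
  rewrite scaler0 addr0; split=> // j; rewrite geq_max => /andP[mj m'j].
  by change (c *: u j + v j = 0); rewrite u0// v0// scaler0 addr0.
have /asboolP[m [xm x0]] : dinj x \in mk_submod H.
  apply: gen_subP xrel => _ [i [y ->]]; apply/asboolP; exists i.+2.
  have -> : dinj y - dinj (f i y) = (-1) *: dinj (f i y) + dinj y.
    by rewrite scaleN1r addrC.
  rewrite dpartial_linear; split=> [|j ij].
    rewrite [dpartial (dinj y) _](dpartial_dinj 1).
    by rewrite [dpartial (dinj (f i y)) _](dpartial_dinj 0) scaleN1r addNr.
  change (-1 *: dinj (f i y) j + dinj y j = 0).
  rewrite !dinj_out ?scaler0 ?addr0// neq_ltn.
    by rewrite (leq_trans _ ij).
  by rewrite ij.
exists m.+1; rewrite -dpartial_dinj; apply: (dpartial_stable x0 xm).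
by rewrite addSn ltnW// ltnS leq_addr.
Qed.

Lemma dlim_class_raise k j (x : E k) : (k <= j)%N -> exists y : E j,
  forall (W : lmodType R) (g : forall i, {linear E i -> W}),
    (forall i z, g i.+1 (f i z) = g i z) -> g k x = g j y.
Proof.
move=> /subnK <-; exists (dlim_trans k (j - k) x) => W g gf.
exact/esym/compat_trans.
Qed.

(** The universal property.  Two representatives of a class may be compared in a
    common degree by [dlim_class_raise], and their difference dies later by
    [dlim_class_eq0]. *)
Lemma dlim_lift (W : lmodType R) (g : forall k, {linear E k -> W}) :
  (forall k x, g k.+1 (f k x) = g k x) ->
  exists G : {linear dlim f -> W}, forall k x, G (dlim_class k x) = g k x.
Proof.
move=> gf.
have g_wd k x k' x' : dlim_class k x = dlim_class k' x' -> g k x = g k' x'.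
  have [y yE] := dlim_class_raise x (leq_maxl k k').
  have [y' y'E] := dlim_class_raise x' (leq_maxr k k').
  rewrite (yE _ g)// (y'E _ g)// (yE _ dlim_class dlim_class_step).
  rewrite (y'E _ dlim_class dlim_class_step).
  move=> /eqP; rewrite -subr_eq0 -linearB => /eqP /dlim_class_eq0 [d dy].
  apply/eqP; rewrite -subr_eq0 -linearB -(compat_trans gf d).
  by rewrite [dlim_trans _ _ _]dy linear0.
pose rep (q : dlim f) := sval (cid (dlim_class_surj q)).
have repP q : exists x, q = dlim_class (rep q) x by rewrite /rep; case: cid.
pose G q := g (rep q) (sval (cid (repP q))).
have GE k x : G (dlim_class k x) = g k x.
  by rewrite /G; case: cid => y /= /g_wd.
have Gl : linear G.
  move=> c p q; have [k [x ->]] := dlim_class_surj p; have [k' [x' ->]] := dlim_class_surj q.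
  have [y yE] := dlim_class_raise x (leq_maxl k k').
  have [y' y'E] := dlim_class_raise x' (leq_maxr k k').
  rewrite (yE _ dlim_class dlim_class_step) (y'E _ dlim_class dlim_class_step).
  by rewrite -linearP !GE linearP.
by exists (mk_linear Gl).
Qed.

End DirectLimit.

Section DirectLimitMap.
Variables (R : comNzRingType) (E E' : nat -> lmodType R).
Variables (f : forall k, {linear E k -> E k.+1}).
Variables (f' : forall k, {linear E' k -> E' k.+1}).
Variables (u : forall k, {linear E k -> E' k}).
Hypothesis uf : forall k x, u k.+1 (f k x) = f' k (u k x).

Fact dlim_map_subproof : exists G : {linear dlim f -> dlim f'},
  forall k x, G (dlim_class f k x) = dlim_class f' k (u k x).
Proof.
apply: (dlim_lift (g := fun k => dlim_class f' k \o u k)) => k x.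
by rewrite /= -[LHS]/(dlim_class f' k.+1 (u k.+1 (f k x))) uf dlim_class_step.
Qed.

Definition dlim_map : {linear dlim f -> dlim f'} := sval (cid dlim_map_subproof).

Lemma dlim_mapE k x : dlim_map (dlim_class f k x) = dlim_class f' k (u k x).
Proof. by rewrite /dlim_map; case: cid. Qed.

End DirectLimitMap.

Lemma weakly_laskerian_sub_im (R : comNzRingType) (W V : lmodType R)
    (f : {linear W -> V}) (S : submodClosed V) :
  weakly_laskerian W -> (forall v, v \in S -> exists w, f w = v) ->
  weakly_laskerian (submod_of S).
Proof.
move=> WW Sf; pose T := preim_submod f S.
have fT x : x \in T -> f x \in S by rewrite in_preim.
apply: (weakly_laskerian_surj (f := submod_map fT)).
  move=> [v vS]; have [w fw] := Sf v vS.
  have wT : w \in T by rewrite in_preim fw.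
  by exists (Sub w wT); apply: val_inj.
apply: (weakly_laskerian_inj (f := (val : {linear submod_of T -> W}))) => // y y0.
exact: val_inj.
Qed.

(** * Limits of Ext along an inverse system *)

Section Systems.
Variables (R : comNzRingType) (X : lmodType R).

Section OneSystem.
Variables (N : nat -> lmodType R) (v : forall k, {linear N k.+1 -> N k}).

Definition sys_Ext n : lmodType R := dlim (fun k => Ext_map X (v k) n).

Definition sys_class n k : {linear Ext X n (N k) -> sys_Ext n} :=
  dlim_class (fun k => Ext_map X (v k) n) k.

Fixpoint sys_trans k d : {linear N (d + k)%N -> N k} :=
  if d is d'.+1 return {linear N (d + k)%N -> N k}
  then sys_trans k d' \o v (d' + k)%N else idfun.

Lemma dlim_trans_Ext n k d (e : Ext X n (N k)) :
  dlim_trans (fun k => Ext_map X (v k) n) k d e = Ext_map X (sys_trans k d) n e.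
Proof.
elim: d => [|d IH]; first by rewrite Ext_map_id.
rewrite (@Ext_map_comp _ _ _ _ _ (v (d + k)%N) (sys_trans k d))//.
by rewrite -IH.
Qed.

Lemma sys_class_surj n (z : sys_Ext n) : exists k e, z = sys_class n k e.
Proof. exact: dlim_class_surj. Qed.

Lemma sys_class_eq0 n k (e : Ext X n (N k)) :
  sys_class n k e = 0 -> exists d, Ext_map X (sys_trans k d) n e = 0.
Proof. by move=> /dlim_class_eq0[d dE]; exists d; rewrite -dlim_trans_Ext. Qed.

Lemma sys_class_trans n k d (e : Ext X n (N k)) :
  sys_class n (d + k)%N (Ext_map X (sys_trans k d) n e) = sys_class n k e.
Proof.
rewrite -dlim_trans_Ext; apply: compat_trans => j x; exact: dlim_class_step.
Qed.

End OneSystem.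

Section SystemMap.
Variables (N N' : nat -> lmodType R).
Variables (v : forall k, {linear N k.+1 -> N k}).
Variables (v' : forall k, {linear N' k.+1 -> N' k}).

Definition is_system_map (f : forall k, {linear N k -> N' k}) : Prop :=
  forall k x, f k (v k x) = v' k (f k.+1 x).

Variables (f : forall k, {linear N k -> N' k}) (fv : is_system_map f).

Lemma sys_trans_map k d x : f k (sys_trans v k d x) = sys_trans v' k d (f (d + k)%N x).
Proof. by elim: d x => [//|d IH] x; rewrite [LHS]IH fv. Qed.

Lemma Ext_map_itrans n k d (e : Ext X n (N' k)) :
  Ext_map X (sys_trans v k d) n (Ext_map X (f k) n e) =
  Ext_map X (f (d + k)%N) n (Ext_map X (sys_trans v' k d) n e).
Proof.
rewrite -(Ext_map_comp (h := f k \o sys_trans v k d))//.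
by apply: Ext_map_comp => x; exact: sys_trans_map.
Qed.

Fact sys_Ext_map_subproof n k (e : Ext X n (N' k)) :
  Ext_map X (f k.+1) n (Ext_map X (v' k) n e) = Ext_map X (v k) n (Ext_map X (f k) n e).
Proof.
rewrite -[RHS](Ext_map_comp (h := f k \o v k))//.
by apply/esym/Ext_map_comp => x; rewrite /= fv.
Qed.

Definition sys_Ext_map n : {linear sys_Ext v' n -> sys_Ext v n} :=
  dlim_map (@sys_Ext_map_subproof n).

Lemma sys_Ext_mapE n k (e : Ext X n (N' k)) :
  sys_Ext_map n (sys_class v' n k e) = sys_class v n k (Ext_map X (f k) n e).
Proof. exact: dlim_mapE. Qed.

End SystemMap.

Section SystemExact.
Variables (A B C : nat -> lmodType R).
Variables (va : forall k, {linear A k.+1 -> A k}).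
Variables (vb : forall k, {linear B k.+1 -> B k}).
Variables (vc : forall k, {linear C k.+1 -> C k}).
Variables (f : forall k, {linear A k -> B k}) (g : forall k, {linear B k -> C k}).
Hypotheses (fv : is_system_map va vb f) (gv : is_system_map vb vc g).
Hypothesis fg : forall k, ses (f k) (g k).

Lemma sys_Ext_exact n z : sys_Ext_map fv n z = 0 -> exists z', sys_Ext_map gv n z' = z.
Proof.
have [k [e ->]] := sys_class_surj z; rewrite sys_Ext_mapE => /sys_class_eq0[d].
rewrite (Ext_map_itrans fv) => /(Ext_exact (fg _))[e' e'E].
by exists (sys_class vc n (d + k)%N e'); rewrite sys_Ext_mapE e'E sys_class_trans.
Qed.

Lemma sys_Ext_inj0 z : sys_Ext_map gv 0 z = 0 -> z = 0.
Proof.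
have [k [e ->]] := sys_class_surj z; rewrite sys_Ext_mapE => /sys_class_eq0[d].
rewrite (Ext_map_itrans gv) => /(Ext_inj0 (fg _)) e0.
by rewrite -(sys_class_trans _ d) e0 linear0.
Qed.

(** The connecting maps of the separate levels are compatible by
    [Ext_conn_natural], and so pass to the limit. *)
Lemma sys_Ext_conn n : exists delta : {linear sys_Ext va n -> sys_Ext vc n.+1},
  forall z, sys_Ext_map gv n.+1 z = 0 -> exists y, delta y = z.
Proof.
pose w k := sval (cid (cone_lift_exists (fg k))).
have wl k : cone_lift (w k) by rewrite /w; case: cid.
have nat_conn k e : Ext_conn X (wl k.+1) n (Ext_map X (va k) n e) =
    Ext_map X (vc k) n.+1 (Ext_conn X (wl k) n e).
  by apply: (Ext_conn_natural (fg k) (b := vb k)) => x.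
exists (dlim_map nat_conn) => z.
have [k [e ->]] := sys_class_surj z; rewrite sys_Ext_mapE => /sys_class_eq0[d].
rewrite (Ext_map_itrans gv) => /(Ext_conn_exact (fg _) (wl (d + k)%N))[e' e'E].
exists (sys_class va n (d + k)%N e').
by rewrite [LHS]dlim_mapE [X in dlim_class _ _ X]e'E; apply: sys_class_trans.
Qed.

End SystemExact.

Lemma sys_Ext_map_comp (N N' N'' : nat -> lmodType R)
    (v : forall k, {linear N k.+1 -> N k}) (v' : forall k, {linear N' k.+1 -> N' k})
    (v'' : forall k, {linear N'' k.+1 -> N'' k})
    (f : forall k, {linear N k -> N' k}) (g : forall k, {linear N' k -> N'' k})
    (h : forall k, {linear N k -> N'' k})
    (fv : is_system_map v v' f) (gv : is_system_map v' v'' g) (hv : is_system_map v v'' h) n z :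
  (forall k x, h k x = g k (f k x)) -> sys_Ext_map hv n z = sys_Ext_map fv n (sys_Ext_map gv n z).
Proof.
move=> hE; have [k [e ->]] := sys_class_surj z; rewrite !sys_Ext_mapE.
by rewrite (Ext_map_comp _ (hE k)).
Qed.

Lemma sys_Ext_map_linear (N N' : nat -> lmodType R)
    (v : forall k, {linear N k.+1 -> N k}) (v' : forall k, {linear N' k.+1 -> N' k})
    (f g h : forall k, {linear N k -> N' k})
    (fv : is_system_map v v' f) (gv : is_system_map v v' g) (hv : is_system_map v v' h) c n z :
  (forall k x, f k x = c *: g k x + h k x) ->
  sys_Ext_map fv n z = c *: sys_Ext_map gv n z + sys_Ext_map hv n z.
Proof.
move=> fE; have [k [e ->]] := sys_class_surj z; rewrite !sys_Ext_mapE.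
by rewrite (Ext_map_linear _ (fE k)) linearP.
Qed.

(** One half of a pro-isomorphism: if the transition maps of N' factor through N,
    a class on N' that dies on N is already zero. *)
Lemma sys_Ext_map_inj (N N' : nat -> lmodType R)
    (v : forall k, {linear N k.+1 -> N k}) (v' : forall k, {linear N' k.+1 -> N' k})
    (f : forall k, {linear N k -> N' k}) (fv : is_system_map v v' f) n z :
  (forall k, exists d (r : {linear N' (d + k)%N -> N k}),
     forall x, f k (r x) = sys_trans v' k d x) ->
  sys_Ext_map fv n z = 0 -> z = 0.
Proof.
move=> fr; have [k [e ->]] := sys_class_surj z; rewrite sys_Ext_mapE => /sys_class_eq0[d].
rewrite (Ext_map_itrans fv) => e0; have [d' [r rE]] := fr (d + k)%N.
rewrite -(sys_class_trans v' d) -(sys_class_trans v' d').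
by rewrite (Ext_map_comp _ (fun x => esym (rE x))) e0 !linear0.
Qed.

End Systems.

(** * Generalized local cohomology as a functor of the module *)

Section ModuleFunctor.
Variables (R : comNzRingType) (a : submodClosed R^o) (X : lmodType R).
Implicit Types A B C M N P : lmodType R.

Notation h n M := (gen_local_coh a n M X).

Lemma act_map (I : submodClosed R^o) M N (f : {linear M -> N}) x :
  x \in ideal_act I M -> f x \in ideal_act I N.
Proof.
rewrite -in_preim; apply: act_subP => r y rI.
by rewrite in_preim linearZ; apply: mem_act.
Qed.

Definition pow_map M N (f : {linear M -> N}) k :
    {linear pow_quot a M k -> pow_quot a N k} :=
  quot_map (act_map (I := ideal_pow a k) f).

Lemma pow_mapE M N (f : {linear M -> N}) k x :
  pow_map f k (quot_proj _ x) = quot_proj _ (f x).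
Proof. exact: quot_mapE. Qed.

Lemma pow_quot_mapE M k x :
  pow_quot_map a M k (quot_proj _ x) = quot_proj _ x.
Proof. exact: quot_mapE. Qed.

Lemma sys_trans_powE M k d x :
  sys_trans (pow_quot_map a M) k d (quot_proj _ x) = quot_proj _ x.
Proof. by elim: d => [//|d IH] /=; rewrite [X in sys_trans _ _ _ X]pow_quot_mapE. Qed.

Lemma pow_map_system M N (f : {linear M -> N}) :
  is_system_map (pow_quot_map a M) (pow_quot_map a N) (pow_map f).
Proof.
by move=> k x; rewrite -(quot_projK x) pow_quot_mapE !pow_mapE pow_quot_mapE.
Qed.

Definition glc_map M N (f : {linear M -> N}) n : {linear h n N -> h n M} :=
  sys_Ext_map X (pow_map_system f) n.

Lemma glc_map_comp M N P (f : {linear M -> N}) (g : {linear N -> P})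
    (k : {linear M -> P}) n z :
  (forall x, k x = g (f x)) -> glc_map k n z = glc_map f n (glc_map g n z).
Proof.
move=> kE; apply: sys_Ext_map_comp => j x.
by rewrite -(quot_projK x) !pow_mapE kE.
Qed.

Lemma glc_map_linear M N (f g k : {linear M -> N}) c n z :
  (forall x, f x = c *: g x + k x) -> glc_map f n z = c *: glc_map g n z + glc_map k n z.
Proof.
move=> fE; apply: sys_Ext_map_linear => j x.
rewrite -(quot_projK x) (pow_mapE f) (pow_mapE g) (pow_mapE k) fE; exact: linearP.
Qed.

Lemma glc_map_id M (f : {linear M -> M}) n z : f =1 id -> glc_map f n z = z.
Proof.
move=> f1; have [k [e ->]] := sys_class_surj z; rewrite [LHS]sys_Ext_mapE Ext_map_id// => x.
by rewrite -(quot_projK x) pow_mapE f1.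
Qed.

Lemma glc_map0 M N (f : {linear M -> N}) n z : (forall x, f x = 0) -> glc_map f n z = 0.
Proof.
move=> f0; apply: (@addrI _ (glc_map f n z)).
rewrite addr0 -{1}[glc_map f n z]scale1r; apply/esym/glc_map_linear => x.
by rewrite !f0 scaler0 addr0.
Qed.

Section ShortExact.
Variables (A B C : lmodType R) (f : {linear A -> B}) (g : {linear B -> C}).
Hypothesis fg : ses f g.

(** The system that makes the sequences short exact at each level; in general it
    is not the system of the quotients A/a^k A. *)
Let K k : lmodType R := submod_of (ker_submod (pow_map g k)).

Fact ker_sys_subproof k x : x \in ker_submod (pow_map g k.+1) ->
  pow_quot_map a B k x \in ker_submod (pow_map g k).
Proof.
rewrite in_ker => /eqP x0; rewrite in_ker (pow_map_system g) x0.
by rewrite [pow_quot_map _ _ _ _]linear0.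
Qed.

Let vK k : {linear K k.+1 -> K k} := submod_map (@ker_sys_subproof k).
Let i k : {linear K k -> pow_quot a B k} := val.

Let i_sys : is_system_map vK (pow_quot_map a B) i. Proof. by []. Qed.

Let i_ses k : ses (i k) (pow_map g k).
Proof.
have [_ _ _ gsurj] := fg; apply: ses_ker => z.
have [b gb] := gsurj (repr z); exists (quot_proj _ b).
by rewrite pow_mapE gb quot_projK.
Qed.

Lemma glc_map_inj0 z : glc_map g 0 z = 0 -> z = 0.
Proof. exact: sys_Ext_inj0 i_ses _. Qed.

Fact to_ker_subproof k x : quot_proj _ (f x) \in ker_submod (pow_map g k).
Proof. by have [_ gf _ _] := fg; rewrite in_ker pow_mapE gf linear0. Qed.

Fact to_ker_linear k : linear (fun x => Sub (quot_proj _ (f x)) (to_ker_subproof k x) : K k).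
Proof. by move=> c x y; apply: val_inj; rewrite /= !linearP. Qed.

Let to_ker k : {linear A -> K k} := mk_linear (@to_ker_linear k).

Fact quot_ker_subproof k x : pow_map f k x \in ker_submod (pow_map g k).
Proof. by rewrite -(quot_projK x) pow_mapE to_ker_subproof. Qed.

Fact quot_ker_linear k :
  linear (fun x => Sub (pow_map f k x) (quot_ker_subproof x) : K k).
Proof. by move=> c x y; apply: val_inj; exact: (linearP (pow_map f k)). Qed.

Let quot_ker k : {linear pow_quot a A k -> K k} := mk_linear (@quot_ker_linear k).

Let quot_ker_sys : is_system_map (pow_quot_map a A) vK quot_ker.
Proof. by move=> k x; apply: val_inj; exact: (pow_map_system f). Qed.

Let to_ker_surj k y : exists x, to_ker k x = y.
Proof.
have [_ _ gker gsurj] := fg; case: y => y yK.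
have: pow_map g k (quot_proj _ (repr y)) = 0 by rewrite quot_projK; apply/eqP; rewrite -in_ker.
rewrite pow_mapE => /quot_proj_eq0 gy.
have [b bk gb] : exists2 b, b \in ideal_act (ideal_pow a k) B & g (repr y) = g b.
  apply/in_imP; apply: act_subP gy => r c rk; have [b <-] := gsurj c.
  by rewrite -linearZ; apply/im_in/mem_act.
have [|x fx] := gker (repr y - b); first by rewrite linearB gb subrr.
exists x; apply: val_inj; rewrite /= -[RHS]quot_projK; apply/eqP.
by rewrite fx quot_projP addrAC subrr add0r submodN.
Qed.

Hypotheses (Bn : noetherian_module B) (afg : fg_submod a).

(** An element of K_(m+k) is the class of f x for some x in A, determined modulo
    A meet a^(m+k) B.  By Artin-Rees this lies in a^k A for a suitable m, so the
    class of x in A/a^k A is well defined. *)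
Lemma ker_pro_iso k : exists d (r : {linear K (d + k)%N -> pow_quot a A k}),
  forall x, quot_ker k (r x) = sys_trans vK k d x.
Proof.
have [finj _ _ _] := fg.
have [m mAR] := artin_rees (im_submod f (full_submod A)) k Bn afg.
exists m.
have [|r rE] := linear_factor (q := quot_proj (ideal_act (ideal_pow a k) A) :
    {linear A -> pow_quot a A k}) (@to_ker_surj (m + k)%N).
  move=> x /(congr1 val) /quot_proj_eq0 x0; apply/quot_proj_eq0.
  have fxm : f x \in ideal_act (ideal_pow a m) B.
    apply: act_subP x0 => r b rk; apply: mem_act; apply: ideal_pow_leq rk.
    exact: leq_addr.
  have : f x \in im_submod f (ideal_act (ideal_pow a k) A).
    apply: smul_subP (mAR _ (im_in f (mem_full x)) fxm) => r _ rk /in_imP[y _ ->].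
    by rewrite -linearZ; apply/im_in/mem_act.
  case/in_imP => y yk /eqP.
  by rewrite -subr_eq0 -linearB => /eqP/finj/eqP; rewrite subr_eq0 => /eqP->.
exists r => y; have [x <-] := to_ker_surj y; rewrite rE.
apply: val_inj; rewrite -[RHS]/(i k _) (sys_trans_map i_sys).
by rewrite [RHS]sys_trans_powE; exact: pow_mapE.
Qed.

Lemma sys_Ext_ker_inj n : exists phi : {linear sys_Ext X vK n -> h n A},
  (forall z, phi z = 0 -> z = 0) /\ forall z, phi (sys_Ext_map X i_sys n z) = glc_map f n z.
Proof.
exists (sys_Ext_map X quot_ker_sys n); split=> z.
  by apply: sys_Ext_map_inj; exact: ker_pro_iso.
by apply/esym/sys_Ext_map_comp.
Qed.

Lemma glc_map_exact n z : glc_map f n z = 0 -> exists z', glc_map g n z' = z.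
Proof.
have [phi [phi_inj phiE]] := sys_Ext_ker_inj n; rewrite -phiE => /phi_inj.
exact: (sys_Ext_exact (pow_map_system g) i_ses).
Qed.

(** The kernel lies in the image of the connecting map of the system K, whose
    limit of Ext's embeds in that of A. *)
Lemma weakly_laskerian_ker_glc_map n : weakly_laskerian (h n A) ->
  weakly_laskerian (submod_of (ker_submod (glc_map g n.+1))).
Proof.
have [phi [phi_inj _]] := sys_Ext_ker_inj n.
have [delta deltaP] := sys_Ext_conn X i_sys (pow_map_system g) i_ses n.
move=> /(weakly_laskerian_inj phi_inj) WK.
apply: (weakly_laskerian_sub_im (f := delta)) => // z.
by rewrite in_ker => /eqP; exact: deltaP.
Qed.

End ShortExact.
End ModuleFunctor.

(** * Permanence of the Noetherian property *)

Section NoetherianModules.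
Variable R : comNzRingType.
Implicit Types U V W : lmodType R.

Lemma noetherian_inj V W (f : {linear V -> W}) :
  (forall v, f v = 0 -> v = 0) -> noetherian_module W -> noetherian_module V.
Proof.
move=> f_inj Wn S; have [s sP] := Wn (im_submod f S).
have [t st tS] : exists2 t : seq V, s = map f t & forall v, v \in t -> v \in S.
  have : forall w, w \in s -> w \in im_submod f S.
    by move=> w ws; rewrite sP; apply: mem_gen.
  elim: {sP} s => [|w s IH] sS; first by exists [::].
  have [v vS wE] := in_imP _ _ _ (sS w (mem_head _ _)).
  have [|t tE tS] := IH; first by move=> u us; apply: sS; rewrite inE us orbT.
  exists (v :: t) => [|u]; first by rewrite wE tE.
  by rewrite inE => /orP[/eqP->|/tS].
exists t => v; apply/idP/idP => [vS|]; last by apply: gen_subP => g; exact: tS.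
have : f v \in im_submod f (gen_submod [set` t]).
  have := im_in f vS; rewrite sP st; apply: gen_subP => _ /mapP[u ut ->].
  by apply: im_in; apply: mem_gen.
case/in_imP => u ut /eqP; rewrite -subr_eq0 -linearB => /eqP/f_inj/eqP.
by rewrite subr_eq0 => /eqP->.
Qed.

Lemma noetherian_submod V (S : submodClosed V) :
  noetherian_module V -> noetherian_module (submod_of S).
Proof.
apply: (noetherian_inj (f := (val : {linear submod_of S -> V}))) => x x0.
exact: val_inj.
Qed.

Lemma noetherian_ffun V t : noetherian_ring R -> noetherian_module V ->
  noetherian_module {ffun 'I_t -> V}.
Proof.
move=> Rn Vn; apply: fg_noetherian => //; have [s sP] := Vn (full_submod V).
have dl j : linear (fun x : V => [ffun i => if i == j then x else 0] : {ffun 'I_t -> V}).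
  move=> c x y; apply/ffunP => i; rewrite !ffunE.
  by case: eqP => // _; rewrite scaler0 addr0.
pose d j := mk_linear (dl j).
exists [seq d j x | j <- enum 'I_t, x <- s] => m; apply/idP/idP => [_|]; last first.
  by move=> _; apply: mem_full.
have -> : m = \sum_j d j (m j).
  apply/ffunP => i; rewrite sum_ffunE (bigD1 i)//= ffunE eqxx big1 ?addr0// => j ji.
  by rewrite ffunE eq_sym (negPf ji).
apply: rpred_sum => j _; rewrite -in_preim.
have : m j \in gen_submod [set` s] by rewrite -sP mem_full.
apply: gen_subP => x xs; rewrite in_preim; apply: mem_gen.
by apply/allpairsP; exists (j, x); split; rewrite ?mem_enum.
Qed.

End NoetherianModules.

Lemma weakly_laskerian_zero (R : comNzRingType) (Y : lmodType R) :
  (forall y : Y, y = 0) -> weakly_laskerian Y.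
Proof.
move=> Y0 S; suff -> : Ass (quot_mod S) = set0 by exact: finite_set0.
rewrite Ass_quot; apply/seteqP; split=> // p [[[_ /negP n1 _] _] [y py]].
by apply: n1; apply/mem_set; rewrite py /colon /mkset [y]Y0 scaler0 rpred0.
Qed.

(** * Cohomology in degrees below n *)

Section Vanishing.
Variables (R : comNzRingType) (a : submodClosed R^o) (X : lmodType R).
Hypothesis Rn : noetherian_ring R.
Implicit Types A B C M N : lmodType R.

Notation h n M := (gen_local_coh a n M X).

Let afg : fg_submod a := Rn a.

Let Rmod_noetherian : noetherian_module R^o := Rn.

(** Degree 0 is included, the kernel being zero there; this lets the inductions
    below treat all degrees alike. *)
Lemma weakly_laskerian_glc_ker n B C (g : {linear B -> C}) : noetherian_module B ->
  (forall z, exists y, g y = z) ->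
  (forall m, n = m.+1 -> weakly_laskerian (h m (submod_of (ker_submod g)))) ->
  weakly_laskerian (submod_of (ker_submod (glc_map a X g n))).
Proof.
move=> Bn gsurj; case: n => [_|n WA].
  apply: weakly_laskerian_zero => -[z zK]; apply: val_inj => /=.
  by apply: (glc_map_inj0 (ses_ker gsurj)); apply/eqP; rewrite -in_ker.
by apply: (weakly_laskerian_ker_glc_map (ses_ker gsurj)) => //; exact: WA.
Qed.

Section Below.
Variable n : nat.
Hypothesis WR : weakly_laskerian (local_coh a n X).
Hypothesis WI : forall m, n = m.+1 ->
  forall I : submodClosed R^o, weakly_laskerian (h m (submod_of I)).

(** Write C as a quotient of R by an ideal I; then h^n(C) is squeezed between
    h^(n-1)(I) and h^n(R). *)
Lemma weakly_laskerian_glc_cyclic C (c : C) : (forall x, exists r, x = r *: c) ->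
  weakly_laskerian (h n C).
Proof.
move=> cC; have gl : linear (fun r : R^o => (r : R) *: c).
  by move=> u x y; rewrite scalerDl -scalerA.
have gsurj z : exists r, mk_linear gl r = z by have [r ->] := cC z; exists r.
apply: (weakly_laskerian_ext (f := glc_map a X (mk_linear gl) n)); last exact: WR.
by apply: weakly_laskerian_glc_ker => // m nm; apply: WI.
Qed.

(** Filter M by the submodules spanned by the tails of a generating sequence:
    the successive quotients are cyclic. *)
Lemma weakly_laskerian_glc_step M : noetherian_module M -> weakly_laskerian (h n M).
Proof.
move=> Mn.
have key (s : seq M) : weakly_laskerian (h n (submod_of (gen_submod [set` s]))).
  elim: s => [|y s IH].
    apply: (weakly_laskerian_glc_cyclic (c := 0)) => -[x xS]; exists 0; apply: val_inj.
    rewrite scaler0 /=; apply/eqP; rewrite -(in_ker (idfun : {linear M -> M})).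
    exact: gen_subP xS.
  pose T := gen_submod [set` s]; pose S := gen_submod [set` y :: s].
  have TS x : x \in T -> x \in S.
    by apply: gen_sub => g gs; rewrite /mkset inE gs orbT.
  pose f : {linear submod_of T -> submod_of S} :=
    submod_map (f := idfun : {linear M -> M}) TS.
  pose g : {linear submod_of S -> quot_mod (im_submod f (full_submod _))} :=
    quot_proj _.
  have fg : ses f g.
    apply: ses_quot => [x /(congr1 val) x0|x]; first by apply: val_inj; exact: x0.
    split=> [/in_imP[u _ ->]|[u <-]]; first by exists u.
    by apply: im_in; exact: mem_full.
  have Sn : noetherian_module (submod_of S) by apply: noetherian_submod.
  have yS : y \in S by apply: mem_gen; rewrite /mkset mem_head.
  have WC : weakly_laskerian (h n (quot_mod (im_submod f (full_submod _)))).
    apply: (weakly_laskerian_glc_cyclic (c := g (Sub y yS))) => q; rewrite -(quot_projK q).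
    have [r rT] := gen_consP (valP (repr q)).
    exists r; rewrite -linearZ; apply/eqP; rewrite quot_projP.
    apply/in_imP; exists (Sub (val (repr q) - r *: y) rT : submod_of T); first exact: mem_full.
    exact: val_inj.
  apply: (weakly_laskerian_ext (f := glc_map a X f n)) => //.
  apply: (weakly_laskerian_sub_im (f := glc_map a X g n)) => // z.
  by rewrite in_ker => /eqP; exact: glc_map_exact.
have [s sM] := Mn (full_submod M).
have Ms x : x \in gen_submod [set` s] by rewrite -sM mem_full.
have jl : linear (fun x : M => Sub x (Ms x) : submod_of (gen_submod [set` s])).
  by move=> c x y; apply: val_inj.
pose i : {linear submod_of (gen_submod [set` s]) -> M} := val.
apply: (weakly_laskerian_inj (f := glc_map a X i n)) (key s) => z z0.
have := @glc_map_comp _ a X _ _ _ (mk_linear jl) i (i \o mk_linear jl) n z (fun=> erefl).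
by rewrite z0 linear0 glc_map_id.
Qed.

End Below.

Lemma weakly_laskerian_glc_below n :
  (forall i : nat, (i < n)%N -> weakly_laskerian (local_coh a i X)) ->
  forall i M, (i < n)%N -> noetherian_module M -> weakly_laskerian (h i M).
Proof.
move=> WR; elim=> [|i IH] M ilt Mn; apply: weakly_laskerian_glc_step => //; try exact: WR.
move=> m [<-] I; apply: IH; first exact: ltnW.
exact: noetherian_submod.
Qed.

End Vanishing.

(** * The elements killed by the ideal *)

Section Annihilated.
Variables (R : comNzRingType) (a : submodClosed R^o) (X N : lmodType R).
Hypothesis aN : forall (r : R) (x : N), (r : R^o) \in a -> r *: x = 0.

Let pow_quot_inj k (x : N) :
  quot_proj (ideal_act (ideal_pow a k.+1) N) x = 0 -> x = 0.
Proof.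
move=> /quot_proj_eq0 xk; apply/eqP.
rewrite -[_ == 0](in_ker (idfun : {linear N -> N})).
apply: act_subP xk => r y rk; rewrite in_ker /= aN//.
apply: smul_subP rk => c u ca _; rewrite -[c *: u]/((c : R) * u : R^o) mulrC.
exact: (rpredZ u ca).
Qed.

(** For k > 0 the quotient N/a^k N is N itself, so the limit system is constant
    from degree 1 on. *)
Lemma weakly_laskerian_glc_annihilated n : weakly_laskerian (Ext X n N) ->
  weakly_laskerian (gen_local_coh a n N X).
Proof.
have qE k : exists q : {linear pow_quot a N k.+1 -> N},
    forall x, q (quot_proj _ x) = x.
  apply: (linear_factor (p := quot_proj _ : {linear N -> pow_quot a N k.+1})
    (q := idfun : {linear N -> N})) => [z|x]; last exact: pow_quot_inj.
  by exists (repr z); exact: quot_projK.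
pose q k := sval (cid (qE k)).
have qK k x : q k (quot_proj _ x) = x by rewrite /q; case: cid.
apply: (weakly_laskerian_surj
  (f := sys_class X (pow_quot_map a N) n 1 \o Ext_map X (q 0%N) n)) => z.
have qcls k e : sys_class X (pow_quot_map a N) n k.+1 (Ext_map X (q k) n e) =
    sys_class X (pow_quot_map a N) n 1 (Ext_map X (q 0%N) n e).
  elim: k => [//|k IH]; rewrite -IH -[RHS](sys_class_trans _ 1).
  congr (sys_class _ _ _ _ _); apply: Ext_map_comp => x.
  rewrite -(quot_projK x) qK; apply: esym.
  by rewrite [LHS](congr1 (q k) (pow_quot_mapE _ k.+1 (repr x))) qK.
have [k [e ->]] := sys_class_surj z.
rewrite -(sys_class_trans _ 1); set e' := Ext_map _ _ _ _.
exists (Ext_map X (quot_proj _ : {linear N -> pow_quot a N k.+1}) n e').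
rewrite [LHS]/= -[LHS]/(sys_class X (pow_quot_map a N) n 1 (Ext_map X (q 0%N) n _)).
rewrite -(qcls k) -(Ext_map_comp (h := quot_proj _ \o q k))//.
congr (sys_class _ _ _ _ _); apply: Ext_map_id => x.
by rewrite -(quot_projK x) /= qK.
Qed.

End Annihilated.

Section Torsion.
Variables (R : comNzRingType) (a : submodClosed R^o) (X M : lmodType R) (n : nat).

Notation H := (gen_local_coh a n M X).

(** A class that lives on M/a^k M is killed by a^k, since multiplication by an
    element of a^k is the zero map of M/a^k M. *)
Lemma gen_local_coh_torsion (z : H) : exists k, forall r : R,
  (r : R^o) \in ideal_pow a k -> r *: z = 0.
Proof.
have [k [e ->]] := sys_class_surj z; exists k => r rk.
rewrite -linearZ; suff -> : r *: e = 0 by rewrite linear0.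
pose id_k : {linear pow_quot a M k -> pow_quot a M k} := idfun.
have := @Ext_map_linear _ X _ _ r (r \*: id_k) id_k \0 n e.
rewrite (Ext_map_id (f := id_k))// (Ext_map0 (f := \0))// addr0 => <-; last first.
  by move=> x; rewrite addr0.
apply: Ext_map0 => x; rewrite -(quot_projK x) /= -linearZ.
by apply/quot_proj_eq0; exact: mem_act.
Qed.

Fact socle_subproof : is_submod [set z : H | forall r : R, (r : R^o) \in a -> r *: z = 0].
Proof.
split=> [r _|c u v u0 v0 r ra]; first by rewrite scaler0.
by rewrite scalerDr scalerA mulrC -scalerA u0// v0// scaler0 addr0.
Qed.

(** The submodule (0 :_H a), isomorphic to Hom(R/a, H). *)
Definition socle : submodClosed H := mk_submod socle_subproof.

Lemma weakly_laskerian_Hom_socle : weakly_laskerian (submod_of socle) ->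
  weakly_laskerian (Hom_mod (quot_mod a) H).
Proof.
pose one : quot_mod a := quot_proj a (1 : R^o).
have oneE (q : quot_mod a) : exists r : R, q = r *: one.
  exists (repr q); rewrite -linearZ.
  by rewrite -[LHS]quot_projK; congr (quot_proj _ _); rewrite /GRing.scale /= mulr1.
have soc (f : Hom_mod (quot_mod a) H) : f one \in socle.
  apply/asboolP => r ra; rewrite -linearZ -[RHS](linear0 f); congr (f _).
  by rewrite -linearZ; apply/quot_proj_eq0; rewrite /GRing.scale /= mulr1.
have evl : linear (fun f : Hom_mod (quot_mod a) H => Sub (f one) (soc f) : submod_of socle).
  by move=> c f g; apply: val_inj.
apply: (weakly_laskerian_inj (f := mk_linear evl)) => f /(congr1 val) /= f1.
apply: linear_ext => q; have [r ->] := oneE q.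
rewrite [LHS]linearZ [f one]f1; exact: scaler0.
Qed.

(** By torsion an associated prime contains a power of each element of a, hence a;
    so an element of which it is the annihilator lies in the socle. *)
Lemma Ass_socle : weakly_laskerian (submod_of socle) -> finite_set (Ass H).
Proof.
move=> /finite_Ass_weakly_laskerian; apply: sub_finite_set => p [pp [z pz]].
have [k zk] := gen_local_coh_torsion z.
have zs : z \in socle.
  apply/asboolP => r ra; have : p (r ^+ k).
    by rewrite pz; apply: zk; apply: expr_ideal_pow.
  suff pr j : p (r ^+ j) -> p r by move=> /pr; rewrite pz.
  elim: j => [p1|j IH]; last by rewrite exprS => /(prime_idealM pp)[|/IH].
  by case: pp => -[_ /negP[]]; apply/mem_set.
split=> //; exists (Sub z zs : submod_of socle); rewrite pz.
by apply/seteqP; split=> r /=; [move=> rz; apply: val_inj | move=> /(congr1 val)].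
Qed.

End Torsion.

Section SocleFinite.
Variables (R : comNzRingType) (a : submodClosed R^o) (X M : lmodType R) (n : nat).
Hypotheses (Rn : noetherian_ring R) (Mn : noetherian_module M).
Variable s : seq R^o.
Hypothesis as_gen : a =i gen_submod [set` s].

Let t := size s.
Let aM := ideal_act a M.

Notation h k N := (gen_local_coh a k N X).

Let coef (j : 'I_t) : R := s`_j.

Let coef_in j : (coef j : R^o) \in a.
Proof. by rewrite as_gen; apply: mem_gen; apply: mem_nth. Qed.

(** The sum is taken over an arbitrary list of indices in order to allow an
    induction on it in [combo_socle]. *)
Fact combo_linear (l : seq 'I_t) :
  linear (fun m : {ffun 'I_t -> M} => \sum_(j <- l) coef j *: m j).
Proof.
move=> c u v; rewrite scaler_sumr -big_split /=; apply: eq_bigr => j _.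
by rewrite !ffunE scalerDr !scalerA mulrC.
Qed.

Let combo l : {linear {ffun 'I_t -> M} -> M} := mk_linear (combo_linear l).

Lemma combo_in l m : combo l m \in aM.
Proof. by apply: rpred_sum => j _; apply: mem_act. Qed.

Fact onto_linear : linear (fun m => Sub (combo (enum 'I_t) m) (combo_in _ m) : submod_of aM).
Proof. by move=> c u v; apply: val_inj; exact: (linearP (combo _)). Qed.

Let onto : {linear {ffun 'I_t -> M} -> submod_of aM} := mk_linear onto_linear.

Lemma onto_surj z : exists m, onto m = z.
Proof.
suff im x : x \in aM -> x \in im_submod (combo (enum 'I_t)) (full_submod _).
  case: z => x xa; have [m _ xm] := in_imP _ _ _ (im x xa).
  by exists m; apply: val_inj; exact: esym xm.
apply: act_subP => r {}x; rewrite as_gen => ra; move: x.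
have HS : is_submod [set r : R^o | forall x,
    (r : R) *: x \in im_submod (combo (enum 'I_t)) (full_submod _)].
  split=> [x|c u v uI vI x]; first by rewrite scale0r rpred0.
  by rewrite scalerDl -scalerA rpredD// rpredZ.
suff /asboolP : (r : R^o) \in mk_submod HS by [].
apply: gen_subP ra => g gs; apply/asboolP => x.
have gt : (index g s < t)%N by rewrite index_mem.
pose m : {ffun 'I_t -> M} := [ffun i => if i == Ordinal gt then x else 0].
suff -> : g *: x = combo (enum 'I_t) m by apply/im_in/mem_full.
rewrite /= big_enum /= (bigD1 (Ordinal gt))//= big1 ?addr0.
  by rewrite ffunE eqxx /coef /= nth_index.
by move=> i ig; rewrite ffunE (negPf ig) scaler0.
Qed.

(** By additivity of h the pullback of z is the sum over j of the pullbacks of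
    s_j z along the projections, and each s_j z vanishes. *)
Lemma combo_socle l (z : h n M) : z \in socle a X M n -> glc_map a X (combo l) n z = 0.
Proof.
move=> /asboolP z0; elim: l => [|j l IH].
  by apply: glc_map0 => m; rewrite /= big_nil.
have prl : linear (fun m : {ffun 'I_t -> M} => m j).
  by move=> c u v; rewrite !ffunE.
rewrite (glc_map_linear (c := coef j) (g := mk_linear prl) (k := combo l)); last first.
  by move=> m; rewrite /= big_cons.
by rewrite IH -linearZ z0// linear0 addr0.
Qed.

Let incl : {linear submod_of aM -> M} := val.

(** Restrict the socle to aM.  The image lies in the kernel of pulling back to M^t
    and the kernel comes from M/aM. *)
Lemma weakly_laskerian_socle : weakly_laskerian (h n (quot_mod aM)) ->
  (forall m N, n = m.+1 -> noetherian_module N -> weakly_laskerian (h m N)) ->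
  weakly_laskerian (submod_of (socle a X M n)).
Proof.
move=> WQ WI; have afg : fg_submod a by exact: Rn.
have Fn : noetherian_module {ffun 'I_t -> M} by apply: noetherian_ffun.
have WK : weakly_laskerian (submod_of (ker_submod (glc_map a X onto n))).
  apply: weakly_laskerian_glc_ker => //; first exact: onto_surj.
  by move=> m nm; apply: WI => //; apply: noetherian_submod.
have sockerP z : z \in socle a X M n -> glc_map a X incl n z \in ker_submod (glc_map a X onto n).
  move=> zs; rewrite in_ker; apply/eqP.
  rewrite -(glc_map_comp (f := onto) (g := incl) (k := combo (enum 'I_t)))//.
  exact: combo_socle.
apply: (weakly_laskerian_ext (f := submod_map sockerP)) WK.
have fg : ses incl (quot_proj aM : {linear M -> quot_mod aM}).
  apply: ses_quot => [x x0|y]; first exact: val_inj.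
  split=> [ya|[x <-]]; last exact: valP.
  by exists (Sub y ya).
have WQim : weakly_laskerian (submod_of (ker_submod (glc_map a X incl n))).
  apply: (weakly_laskerian_sub_im
    (f := glc_map a X (quot_proj aM : {linear M -> quot_mod aM}) n)) => // z.
  by rewrite in_ker => /eqP; exact: glc_map_exact.
have kerP (z : submod_of (socle a X M n)) : z \in ker_submod (submod_map sockerP) ->
    (val : {linear submod_of (socle a X M n) -> h n M}) z \in ker_submod (glc_map a X incl n).
  by rewrite !in_ker => /eqP /(congr1 val) /= ->.
apply: (weakly_laskerian_inj (f := submod_map kerP)) WQim => z /(congr1 val) /= z0.
by apply: val_inj; apply: val_inj.
Qed.

End SocleFinite.

Theorem corollary3p11 (R : comNzRingType) (a : submodClosed R^o)
    (M X : lmodType R) (n : nat) :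
  noetherian_ring R ->
  fg_module M ->
  weakly_laskerian (Ext X n (quot_mod (ideal_act a M))) ->
  (forall i : nat, (i < n)%N -> weakly_laskerian (local_coh a i X)) ->
  weakly_laskerian (Hom_mod (quot_mod a) (gen_local_coh a n M X)) /\
  finite_set (Ass (gen_local_coh a n M X)).
Proof.
move=> Rn Mfg WE WR; have Mn := fg_noetherian Rn Mfg.
have [s sa] := Rn a.
suff Wsoc : weakly_laskerian (submod_of (socle a X M n)).
  by split; [exact: weakly_laskerian_Hom_socle | exact: Ass_socle].
apply: (weakly_laskerian_socle Rn Mn sa) => [|m N nm Nn].
  apply: weakly_laskerian_glc_annihilated WE => r x ra; rewrite -(quot_projK x) -linearZ.
  by apply/quot_proj_eq0; apply: mem_act.
by apply: weakly_laskerian_glc_below WR _ _ _ Nn => //; rewrite nm.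
Qed.
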